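(* Let $R$ be a discrete commutative semiring (regarded as a localic semiring whose opens are the subsets of $R$). Then $R$ is approximable and the quantic spectrum of $R$ is given by the usual quantale of (set-theoretic) ideals of $R$. The localic spectrum of $R$ is then the usual pointfree Zariski spectrum of $R$.
   Context: Everything is constructive. $\Omega$ is the frame of truth values. $\mathbf{Sup}$ is the symmetric monoidal closed category of suplattices (posets with arbitrary joins, join-preserving maps) with unit $\Omega$ and tensor $\otimes$ classifying maps preserving joins in each variable. Quantales are commutative monoids in $\mathbf{Sup}$; a quantale is two-sided if its unit is its top element; $\mathbf{Quant}_\top$ is the category of two-sided quantales. Frames are the two-sided quantales with idempotent multiplication. Coproducts $\oplus$ of two-sided quantales or frames have underlying suplattice $\otimes$ with componentwise multiplication. $\mathcal{O}X$ is the frame of opens of a locale $X$. For a commutative localic semiring $R$ (commutative semiring object with $0,1$ in locales), $\epsilon_0,\epsilon_1\colon\mathcal{O}R\to\Omega$ and $\mu_+,\mu_\times\colon\mathcal{O}R\to\mathcal{O}R\oplus\mathcal{O}R$ are the frame maps corresponding to zero, one, addition, multiplication; $\iota_1,\iota_2\colon\mathcal{O}R\to\mathcal{O}R\oplus\mathcal{O}R$ are the coproduct injections. An overt localic semiring $R$ is approximable if the suplattice $\mathscr{S}R=\{s\in\mathcal{O}R\mid\mu_\times(s)\le\iota_1(s)\}$ of saturated opens is dualisable in $\mathbf{Sup}$. (Discrete locales are overt.) $\overline{\mathrm{OPAI}}_R\colon\mathbf{Quant}_\top\to\mathbf{Set}$ sends $Q$ to the set of $u\in Q\oplus\mathcal{O}R$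 with $(Q\oplus\epsilon_0)(u)=0$, $(Q\oplus\epsilon_1)(u)=1$, $(Q\oplus\mu_+)(u)\le(Q\oplus\iota_1)(u)\vee(Q\oplus\iota_2)(u)$, $(Q\oplus\mu_\times)(u)=(Q\oplus\iota_1)(u)\cdot(Q\oplus\iota_2)(u)$, acting on morphisms $g$ by $g\oplus\mathcal{O}R$. The quantic spectrum of $R$ is the representing object of $\overline{\mathrm{OPAI}}_R$, when it exists. The localic spectrum is the representing object of $\mathrm{OPAI}_R\colon\mathbf{Loc}^{\mathrm{op}}\to\mathbf{Set}$, $\mathrm{OPAI}_R(X)=\overline{\mathrm{OPAI}}_R(\mathcal{O}X)$. The usual quantale of ideals of a discrete semiring $R$ consists of the subsets $I\subseteq R$ with $0\in I$, $I+I\subseteq I$, $RI\subseteq I$, ordered by inclusion, with multiplication of ideals ($IJ$ is the ideal generated by products $ij$). The pointfree Zariski spectrum is the locale whose frame is presented by $\langle\overline{f}: f\in R\mid\overline{0}=0,\ \overline{f+g}\le\overline{f}\vee\overline{g},\ \overline{1}=1,\ \overline{fg}=\overline{f}\wedge\overline{g}\rangle$. *)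

(* Defs.v *)
From Stdlib Require Import ssreflect ssrfun ssrbool.
From Stdlib Require Import FunctionalExtensionality PropExtensionality.
From Stdlib Require Import ProofIrrelevance Ring_theory.

Set Implicit Arguments.
Unset Strict Implicit.
Unset Printing Implicit Defensive.
#[local] Obligation Tactic := idtac.

(* Everything below is constructive: truth values are [Prop], subsets of [T]
   are maps [T -> Prop], and only the extensionality axioms and proof
   irrelevance are used, so that Leibniz equality is the intended equality on
   subsets, on subtypes, and on morphisms. *)

Lemma predext {T : Type} (U V : T -> Prop) : (forall x, U x <-> V x) -> U = V.
Proof.
by move=> E; apply: functional_extensionality => x; apply: propositional_extensionality.
Qed.

Lemma predext2 {S T : Type} (U V : S -> T -> Prop) :
  (forall x y, U x y <-> V x y) -> U = V.
Proof. by move=> E; apply: functional_extensionality => x; apply: predext. Qed.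

Lemma sig_ext {T : Type} (P : T -> Prop) (x y : {t | P t}) :
  proj1_sig x = proj1_sig y -> x = y.
Proof. by case: x y => [x px] [y py] /= E; apply: subset_eq_compat. Qed.

Definition image {X Y : Type} (f : X -> Y) (S : X -> Prop) : Y -> Prop :=
  fun y => exists2 x, S x & y = f x.

Record suplattice := Suplattice {
  sl_car :> Type;
  le : sl_car -> sl_car -> Prop;
  sup : (sl_car -> Prop) -> sl_car;
  le_refl : forall x, le x x;
  le_trans : forall x y z, le x y -> le y z -> le x z;
  le_antisym : forall x y, le x y -> le y x -> x = y;
  sup_le : forall S x, le (sup S) x <-> (forall y, S y -> le y x) }.

Arguments le {s} x y.
Arguments sup {s} S.
Arguments le_refl {s} x.
Arguments le_trans {s x y z} _ _.
Arguments le_antisym {s x y} _ _.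
Arguments sup_le {s} S x.

Declare Scope suplattice_scope.
Delimit Scope suplattice_scope with sl.
Local Open Scope suplattice_scope.
Notation "x ⊑ y" := (le x y) (at level 70, no associativity) : suplattice_scope.

Definition bot {A : suplattice} : A := sup (fun _ => False).
Definition top {A : suplattice} : A := sup (fun _ => True).
Definition join {A : suplattice} (x y : A) : A := sup (fun z => z = x \/ z = y).
Notation "x ⊔ y" := (join x y) (at level 50, left associativity) : suplattice_scope.

Lemma sup_ub {A : suplattice} (S : A -> Prop) x : S x -> x ⊑ sup S.
Proof. by move=> Sx; move: (proj1 (sup_le S (sup S)) (le_refl _)); apply. Qed.

Lemma le_top {A : suplattice} (x : A) : x ⊑ top.
Proof. exact: sup_ub. Qed.

Lemma bot_le {A : suplattice} (x : A) : bot ⊑ x.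
Proof. by apply/sup_le. Qed.

Lemma join_le {A : suplattice} (x y z : A) : x ⊔ y ⊑ z <-> x ⊑ z /\ y ⊑ z.
Proof.
split=> [/sup_le H|[xz yz]]; first by split; apply: H; [left|right].
by apply/sup_le => w [->|->].
Qed.

Lemma eq_by_ub {A : suplattice} (x y : A) : (forall z, x ⊑ z <-> y ⊑ z) -> x = y.
Proof. by move=> E; apply: le_antisym; apply/E; apply: le_refl. Qed.

Lemma sup_image_le {A : suplattice} {X : Type} (f : X -> A) S z :
  sup (image f S) ⊑ z <-> forall x, S x -> f x ⊑ z.
Proof.
rewrite sup_le; split=> [H x Sx|H y [x Sx ->]]; last exact: H.
by apply: H; exists x.
Qed.

Record supmap (A B : suplattice) := Supmap {
  sm_fun :> A -> B;
  sm_sup : forall S, sm_fun (sup S) = sup (image sm_fun S) }.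

Lemma supmap_ext (A B : suplattice) (f g : supmap A B) : (forall x, f x = g x) -> f = g.
Proof.
case: f g => [f hf] [g hg] /= E.
have Efg : f = g by apply: functional_extensionality.
by subst g; rewrite (proof_irrelevance _ hf hg).
Qed.

Lemma sup2_join (A : suplattice) (x y : A) : x ⊑ y -> x ⊔ y = y.
Proof.
move=> xy; apply: le_antisym; first by apply/join_le; split=> //; apply: le_refl.
by apply: sup_ub; right.
Qed.

Lemma supmap_join (A B : suplattice) (f : supmap A B) x y : f (x ⊔ y) = f x ⊔ f y.
Proof.
apply: eq_by_ub => z; rewrite sm_sup sup_image_le join_le.
split=> [H|[? ?] w [->|->] //]; by split; apply: H; [left|right].
Qed.

Lemma supmap_bot (A B : suplattice) (f : supmap A B) : f bot = bot.
Proof. by apply: eq_by_ub => z; rewrite sm_sup sup_image_le /bot sup_le. Qed.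

Lemma supmap_mono (A B : suplattice) (f : supmap A B) x y : x ⊑ y -> f x ⊑ f y.
Proof. by move=> /sup2_join <-; rewrite supmap_join; apply: sup_ub; left. Qed.

Lemma supmap_sup_le (A B : suplattice) (f : supmap A B) S z :
  f (sup S) ⊑ z <-> forall x, S x -> f x ⊑ z.
Proof. by rewrite sm_sup sup_image_le. Qed.

Program Definition supid (A : suplattice) : supmap A A := @Supmap A A (fun x => x) _.
Next Obligation.
by move=> A S; apply: eq_by_ub => z; rewrite sup_image_le sup_le.
Qed.

Program Definition supcomp (A B C : suplattice) (g : supmap B C) (f : supmap A B) :
  supmap A C := @Supmap A C (fun x => g (f x)) _.
Next Obligation.
move=> A B C g f S; apply: eq_by_ub => z; rewrite sm_sup supmap_sup_le sup_image_le.
by split=> [H x Sx|H y [x Sx ->]]; apply: H => //; exists x.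
Qed.

Lemma supcompE (A B C : suplattice) (g : supmap B C) (f : supmap A B) x :
  supcomp g f x = g (f x).
Proof. by []. Qed.

Program Definition Omega : suplattice :=
  @Suplattice Prop (fun p q => p -> q) (fun S => exists p, S p /\ p) _ _ _ _.
Next Obligation. by []. Qed.
Next Obligation. by move=> p q r pq qr /pq. Qed.
Next Obligation. by move=> p q pq qp; apply: propositional_extensionality. Qed.
Next Obligation.
move=> S q; split=> [H p Sp hp|H [p [Sp hp]]]; last exact: H hp.
by apply: H; exists p.
Qed.

Record bimap (A B C : suplattice) := Bimap {
  bm_fun :> A -> B -> C;
  bm_supl : forall S b, bm_fun (sup S) b = sup (image (fun a => bm_fun a b) S);
  bm_supr : forall a S, bm_fun a (sup S) = sup (image (bm_fun a) S) }.

(* An element of the tensor product is encoded as the set of pairs [(a, b)]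
   whose pure tensor lies below it; [tensor_universal] is the universal
   property. *)
Definition tclosed {A B : suplattice} (U : A -> B -> Prop) : Prop :=
  [/\ forall a b a' b', U a b -> a' ⊑ a -> b' ⊑ b -> U a' b',
      forall (S : A -> Prop) b, (forall a, S a -> U a b) -> U (sup S) b
    & forall a (S : B -> Prop), (forall b, S b -> U a b) -> U a (sup S)].

Definition tclosure {A B : suplattice} (W : A -> B -> Prop) : A -> B -> Prop :=
  fun a b => forall U, tclosed U -> (forall x y, W x y -> U x y) -> U a b.

Lemma tclosure_closed {A B : suplattice} (W : A -> B -> Prop) : tclosed (tclosure W).
Proof.
split=> [a b a' b' H la lb U cU WU|S b H U cU WU|a S H U cU WU]; case: (cU) => c1 c2 c3.
- by apply: (c1 a b) => //; apply: H.
- by apply: c2 => a Sa; apply: H.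
- by apply: c3 => b Sb; apply: H.
Qed.

Lemma tclosure_sub {A B : suplattice} (W : A -> B -> Prop) a b : W a b -> tclosure W a b.
Proof. by move=> Wab U _; apply. Qed.

Definition tcar (A B : suplattice) := {U : A -> B -> Prop | tclosed U}.

Definition tmem {A B : suplattice} (U : tcar A B) : A -> B -> Prop := proj1_sig U.

Definition tgen {A B : suplattice} (W : A -> B -> Prop) : tcar A B :=
  exist _ (tclosure W) (tclosure_closed W).

Program Definition tensor (A B : suplattice) : suplattice :=
  @Suplattice (tcar A B)
    (fun U V => forall a b, tmem U a b -> tmem V a b)
    (fun F => tgen (fun a b => exists2 U, F U & tmem U a b)) _ _ _ _.
Next Obligation. by []. Qed.
Next Obligation. by move=> A B U V W UV VW a b /UV/VW. Qed.
Next Obligation.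
by move=> A B U V UV VU; apply: sig_ext; apply: predext2 => a b; split; [apply: UV|apply: VU].
Qed.
Next Obligation.
move=> A B F V; split=> [H U FU a b Uab|H a b Fab].
  by apply: H; apply: tclosure_sub; exists U.
by apply: Fab => [|x y [U FU]]; [exact: proj2_sig V|apply: H].
Qed.

Arguments tensor : simpl never.
Canonical tensor.
Notation "A ⊗ B" := (tensor A B) (at level 40, left associativity) : suplattice_scope.

Definition tens {A B : suplattice} (a : A) (b : B) : A ⊗ B :=
  tgen (fun x y => x = a /\ y = b).

Lemma tens_le {A B : suplattice} (a : A) (b : B) (U : A ⊗ B) :
  tens a b ⊑ U <-> tmem U a b.
Proof.
split=> [H|Uab x y H]; first by apply: H; apply: tclosure_sub.
by apply: H => [|? ? [-> ->] //]; exact: proj2_sig U.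
Qed.

Lemma tmem_le {A B : suplattice} (U : A ⊗ B) a b a' b' :
  tmem U a b -> a' ⊑ a -> b' ⊑ b -> tmem U a' b'.
Proof. by case: U => U [H1 H2 H3]; apply: H1. Qed.

Lemma tmem_supl {A B : suplattice} (U : A ⊗ B) (S : A -> Prop) b :
  (forall a, S a -> tmem U a b) -> tmem U (sup S) b.
Proof. by case: U => U [H1 H2 H3]; apply: H2. Qed.

Lemma tmem_supr {A B : suplattice} (U : A ⊗ B) a (S : B -> Prop) :
  (forall b, S b -> tmem U a b) -> tmem U a (sup S).
Proof. by case: U => U [H1 H2 H3]; apply: H3. Qed.

Lemma tens_mono {A B : suplattice} (a a' : A) (b b' : B) :
  a ⊑ a' -> b ⊑ b' -> tens a b ⊑ tens a' b'.
Proof.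
move=> la lb; apply/tens_le; apply: (tmem_le (a := a') (b := b')) => //.
by apply/tens_le; apply: le_refl.
Qed.

Program Definition tens_bimap (A B : suplattice) : bimap A B (A ⊗ B) := @Bimap A B (A ⊗ B) tens _ _.
Next Obligation.
move=> A B S b; apply: eq_by_ub => U; rewrite tens_le sup_image_le.
split=> [H a Sa|H]; last by apply: tmem_supl => a /H/tens_le.
by apply/tens_le; apply: tmem_le H _ (le_refl _); apply: sup_ub.
Qed.
Next Obligation.
move=> A B a S; apply: eq_by_ub => U; rewrite tens_le sup_image_le.
split=> [H b Sb|H]; last by apply: tmem_supr => b /H/tens_le.
by apply/tens_le; apply: tmem_le H (le_refl _) _; apply: sup_ub.
Qed.

Lemma tens_supl (A B : suplattice) (S : A -> Prop) (b : B) :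
  tens (sup S) b = sup (image (fun a => tens a b) S).
Proof. exact: (bm_supl (tens_bimap A B)). Qed.

Lemma tens_supr (A B : suplattice) (a : A) (S : B -> Prop) :
  tens a (sup S) = sup (image (tens a) S).
Proof. exact: (bm_supr (tens_bimap A B)). Qed.

Lemma tensor_sup_le {A B : suplattice} (W : A -> B -> Prop) (U : A ⊗ B) :
  sup (fun t => exists a b, W a b /\ t = tens a b) ⊑ U <-> forall a b, W a b -> tmem U a b.
Proof.
rewrite sup_le; split=> [H a b Wab|H t [a [b [Wab ->]]]]; last by apply/tens_le/H.
by apply/tens_le; apply: H; exists a, b.
Qed.

Lemma tensor_gen {A B : suplattice} (U : A ⊗ B) :
  U = sup (fun t => exists a b, tmem U a b /\ t = tens a b).
Proof. by apply: eq_by_ub => V; rewrite tensor_sup_le. Qed.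

Definition tlift_fun {A B C : suplattice} (f : A -> B -> C) (U : A ⊗ B) : C :=
  sup (fun c => exists a b, tmem U a b /\ c = f a b).

Lemma tlift_le {A B C : suplattice} (f : A -> B -> C) (U : A ⊗ B) c :
  tlift_fun f U ⊑ c <-> forall a b, tmem U a b -> f a b ⊑ c.
Proof.
rewrite sup_le; split=> [H a b Uab|H d [a [b [Uab ->]]]]; last exact: H.
by apply: H; exists a, b.
Qed.

Lemma bm_suplE (A B C : suplattice) (f : bimap A B C) S b c :
  f (sup S) b ⊑ c <-> forall a, S a -> f a b ⊑ c.
Proof. by rewrite bm_supl sup_image_le. Qed.

Lemma bm_suprE (A B C : suplattice) (f : bimap A B C) a S c :
  f a (sup S) ⊑ c <-> forall b, S b -> f a b ⊑ c.
Proof. by rewrite bm_supr sup_image_le. Qed.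

Definition bm_left (A B C : suplattice) (f : bimap A B C) (b : B) : supmap A C :=
  @Supmap A C (fun a => f a b) (fun S => bm_supl f S b).

Definition bm_right (A B C : suplattice) (f : bimap A B C) (a : A) : supmap B C :=
  @Supmap B C (f a) (bm_supr f a).

Lemma bm_mono (A B C : suplattice) (f : bimap A B C) a a' b b' :
  a ⊑ a' -> b ⊑ b' -> f a b ⊑ f a' b'.
Proof.
move=> la lb; apply: (le_trans (y := f a' b)).
  exact: (supmap_mono (bm_left f b)).
exact: (supmap_mono (bm_right f a')).
Qed.

Lemma below_closed (A B C : suplattice) (f : bimap A B C) c : tclosed (fun a b => f a b ⊑ c).
Proof.
split=> [a b a' b' H la lb|S b H|a S H].
- exact: le_trans (bm_mono f la lb) H.
- by apply/bm_suplE.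
- by apply/bm_suprE.
Qed.

Lemma tlift_sup (A B C : suplattice) (f : bimap A B C) F :
  tlift_fun f (sup F) = sup (image (tlift_fun f) F).
Proof.
apply: eq_by_ub => c; rewrite tlift_le sup_image_le; split=> [H U FU|H a b].
  by apply/tlift_le => a b Uab; apply: H; apply: tclosure_sub; exists U.
move=> Fab; apply: (Fab (fun a b => f a b ⊑ c)); first exact: below_closed.
by move=> x y [U FU Uxy]; move/tlift_le: (H U FU); apply.
Qed.

Definition tlift (A B C : suplattice) (f : bimap A B C) : supmap (A ⊗ B) C :=
  @Supmap (A ⊗ B) C (tlift_fun f) (tlift_sup f).

Lemma tliftE (A B C : suplattice) (f : bimap A B C) U c :
  tlift f U ⊑ c <-> forall a b, tmem U a b -> f a b ⊑ c.
Proof. exact: tlift_le. Qed.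

Lemma tlift_tens (A B C : suplattice) (f : bimap A B C) a b : tlift f (tens a b) = f a b.
Proof.
apply: eq_by_ub => c; rewrite /= tlift_le; split=> [H|H x y xy]; last first.
  by apply: (xy (fun a b => f a b ⊑ c)); [exact: below_closed|move=> ? ? [-> ->]].
by apply: H; apply: tclosure_sub.
Qed.

Lemma tensor_ext (A B C : suplattice) (f g : supmap (A ⊗ B) C) :
  (forall a b, f (tens a b) = g (tens a b)) -> f = g.
Proof.
move=> E; apply: supmap_ext => U; rewrite (tensor_gen U) !sm_sup.
congr sup; apply: predext => c.
split=> [[t [a [b [Uab ->]]] ->]|[t [a [b [Uab ->]]] ->]];
  exists (tens a b) => //; by exists a, b.
Qed.

Lemma tensor_universal (A B C : suplattice) (f : bimap A B C) :
  exists! h : supmap (A ⊗ B) C, forall a b, h (tens a b) = f a b.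
Proof.
exists (tlift f); split=> [a b|h H]; first exact: tlift_tens.
by apply: tensor_ext => a b; rewrite H tlift_tens.
Qed.

Program Definition tmap_bimap (A B C D : suplattice) (f : supmap A C) (g : supmap B D) :
  bimap A B (C ⊗ D) := @Bimap A B (C ⊗ D) (fun a b => tens (f a) (g b)) _ _.
Next Obligation.
move=> A B C D f g S b /=; rewrite sm_sup tens_supl.
apply: eq_by_ub => U; rewrite !sup_image_le; split=> [H a Sa|H c [a Sa ->]]; last exact: H.
by apply: H; exists a.
Qed.
Next Obligation.
move=> A B C D f g a S /=; rewrite sm_sup tens_supr.
apply: eq_by_ub => U; rewrite !sup_image_le; split=> [H b Sb|H c [b Sb ->]]; last exact: H.
by apply: H; exists b.
Qed.

Definition tmap (A B C D : suplattice) (f : supmap A C) (g : supmap B D) :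
  supmap (A ⊗ B) (C ⊗ D) := tlift (tmap_bimap f g).

Lemma tmap_tens (A B C D : suplattice) (f : supmap A C) (g : supmap B D) a b :
  tmap f g (tens a b) = tens (f a) (g b).
Proof. exact: tlift_tens. Qed.

Lemma tmap_id (A B : suplattice) : tmap (supid A) (supid B) = supid (A ⊗ B).
Proof. by apply: tensor_ext => a b; rewrite tmap_tens. Qed.

Lemma tmap_comp (A B C A' B' C' : suplattice) (f : supmap A B) (g : supmap B C)
    (f' : supmap A' B') (g' : supmap B' C') :
  tmap (supcomp g f) (supcomp g' f') = supcomp (tmap g g') (tmap f f').
Proof. by apply: tensor_ext => a b; rewrite supcompE !tmap_tens. Qed.

Program Definition tassoc_in (A B C : suplattice) (c : C) : bimap A B (A ⊗ (B ⊗ C)) :=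
  @Bimap A B (A ⊗ (B ⊗ C)) (fun a b => tens a (tens b c)) _ _.
Next Obligation. by move=> A B C c S b /=; rewrite tens_supl. Qed.
Next Obligation.
move=> A B C c a S /=; rewrite tens_supl tens_supr.
apply: eq_by_ub => U; rewrite !sup_image_le; split=> [H b Sb|H d [b Sb ->]]; last exact: H.
by apply: H; exists b.
Qed.

Program Definition tassoc_bimap (A B C : suplattice) : bimap (A ⊗ B) C (A ⊗ (B ⊗ C)) :=
  @Bimap (A ⊗ B) C (A ⊗ (B ⊗ C)) (fun U c => tlift (tassoc_in A B c) U) _ _.
Next Obligation. by move=> A B C F c; exact: tlift_sup. Qed.
Next Obligation.
move=> A B C U S; apply: eq_by_ub => V; cbv beta; rewrite sup_image_le tliftE.
split=> [H c Sc|H a b Uab].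
  apply/tliftE => a b Uab; apply: le_trans (H a b Uab).
  apply: tens_mono (le_refl _) _; apply: tens_mono (le_refl _) _; exact: sup_ub.
change (tens a (tens b (sup S)) ⊑ V); rewrite tens_supr tens_supr sup_image_le.
by move=> ? [c Sc ->]; move/tliftE: (H c Sc); apply.
Qed.

Definition tassoc (A B C : suplattice) : supmap ((A ⊗ B) ⊗ C) (A ⊗ (B ⊗ C)) :=
  tlift (tassoc_bimap A B C).

Lemma tassoc_tens (A B C : suplattice) (a : A) (b : B) (c : C) :
  tassoc A B C (tens (tens a b) c) = tens a (tens b c).
Proof. by rewrite /tassoc tlift_tens; exact: (tlift_tens (tassoc_in A B c)). Qed.

Program Definition tassoc_inv_in (A B C : suplattice) (a : A) : bimap B C ((A ⊗ B) ⊗ C) :=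
  @Bimap B C ((A ⊗ B) ⊗ C) (fun b c => tens (tens a b) c) _ _.
Next Obligation.
move=> A B C a S c /=; rewrite tens_supr tens_supl.
apply: eq_by_ub => U; rewrite !sup_image_le; split=> [H b Sb|H d [b Sb ->]]; last exact: H.
by apply: H; exists b.
Qed.
Next Obligation. by move=> A B C a b S /=; rewrite tens_supr. Qed.

Program Definition tassoc_inv_bimap (A B C : suplattice) : bimap A (B ⊗ C) ((A ⊗ B) ⊗ C) :=
  @Bimap A (B ⊗ C) ((A ⊗ B) ⊗ C) (fun a U => tlift (tassoc_inv_in B C a) U) _ _.
Next Obligation.
move=> A B C S U; apply: eq_by_ub => V; cbv beta; rewrite sup_image_le tliftE.
split=> [H a Sa|H b c Ubc].
  apply/tliftE => b c Ubc; apply: le_trans (H b c Ubc).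
  apply: tens_mono _ (le_refl _); apply: tens_mono _ (le_refl _); exact: sup_ub.
change (tens (tens (sup S) b) c ⊑ V); rewrite tens_supl tens_supl sup_image_le.
by move=> ? [a Sa ->]; move/tliftE: (H a Sa); apply.
Qed.
Next Obligation. by move=> A B C a F; exact: tlift_sup. Qed.

Definition tassoc_inv (A B C : suplattice) : supmap (A ⊗ (B ⊗ C)) ((A ⊗ B) ⊗ C) :=
  tlift (tassoc_inv_bimap A B C).

Lemma tassoc_inv_tens (A B C : suplattice) (a : A) (b : B) (c : C) :
  tassoc_inv A B C (tens a (tens b c)) = tens (tens a b) c.
Proof. by rewrite /tassoc_inv tlift_tens; exact: (tlift_tens (tassoc_inv_in B C a)). Qed.

Definition restrict {A : suplattice} (p : Prop) (a : A) : A := sup (fun x => x = a /\ p).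

Lemma restrict_le {A : suplattice} (p : Prop) (a b : A) :
  restrict p a ⊑ b <-> (p -> a ⊑ b).
Proof. by rewrite sup_le; split=> [H hp|H x [-> /H]] //; apply: H. Qed.

Program Definition tlunit_bimap (A : suplattice) : bimap Omega A A :=
  @Bimap Omega A A (fun p a => restrict p a) _ _.
Next Obligation.
move=> A S a; apply: eq_by_ub => x; cbv beta; rewrite sup_image_le restrict_le.
split=> [H p Sp|H [p [Sp hp]]]; first by apply/restrict_le => hp; apply: H; exists p.
by move/restrict_le: (H p Sp); apply.
Qed.
Next Obligation.
move=> A p S; apply: eq_by_ub => x; cbv beta; rewrite sup_image_le restrict_le.
split=> [H a Sa|H hp].
  by apply/restrict_le => hp; apply: le_trans (H hp); apply: sup_ub.
by apply/sup_le => a Sa; move/restrict_le: (H a Sa); apply.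
Qed.

Definition tlunit (A : suplattice) : supmap (Omega ⊗ A) A := tlift (tlunit_bimap A).
Definition tlunit_inv (A : suplattice) : supmap A (Omega ⊗ A) :=
  bm_right (tens_bimap Omega A) True.

Program Definition trunit_bimap (A : suplattice) : bimap A Omega A :=
  @Bimap A Omega A (fun a p => restrict p a) _ _.
Next Obligation. by move=> A S p; exact: (bm_supr (tlunit_bimap A)). Qed.
Next Obligation. by move=> A a S; exact: (bm_supl (tlunit_bimap A)). Qed.

Definition trunit (A : suplattice) : supmap (A ⊗ Omega) A := tlift (trunit_bimap A).
Definition trunit_inv (A : suplattice) : supmap A (A ⊗ Omega) :=
  bm_left (tens_bimap A Omega) True.

Lemma tens_restrict (A B : suplattice) (p : Prop) (a : A) (b : B) :
  tens (restrict p a) b = tens a (restrict p b).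
Proof.
apply: eq_by_ub => U.
rewrite tens_supl tens_supr !sup_image_le.
by split=> H x [-> hp]; apply: H.
Qed.

Lemma Omega_restrict (p : Omega) : p = restrict (A := Omega) p True.
Proof.
apply: eq_by_ub => q; rewrite restrict_le; split=> H hp; first by move=> _; exact: H.
exact: H.
Qed.

Lemma restrictT (A : suplattice) (a : A) : restrict True a = a.
Proof. by apply: eq_by_ub => x; rewrite restrict_le; split=> // H; apply: H. Qed.

Lemma tlunitK (A : suplattice) :
  supcomp (tlunit A) (tlunit_inv A) = supid A /\ supcomp (tlunit_inv A) (tlunit A) = supid _.
Proof.
split; first by apply: supmap_ext => a; rewrite supcompE /tlunit tlift_tens /= restrictT.
apply: tensor_ext => p a; rewrite supcompE /tlunit tlift_tens /=.
by rewrite -(tens_restrict (A := Omega) p) -Omega_restrict.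
Qed.

Lemma trunitK (A : suplattice) :
  supcomp (trunit A) (trunit_inv A) = supid A /\ supcomp (trunit_inv A) (trunit A) = supid _.
Proof.
split; first by apply: supmap_ext => a; rewrite supcompE /trunit tlift_tens /= restrictT.
apply: tensor_ext => a p; rewrite supcompE /trunit tlift_tens /=.
by rewrite (tens_restrict (B := Omega) p) -Omega_restrict.
Qed.

Definition dualisable (A : suplattice) : Prop :=
  exists (D : suplattice) (eta : supmap Omega (A ⊗ D)) (eps : supmap (D ⊗ A) Omega),
    (forall a : A,
       trunit A (tmap (supid A) eps
         (tassoc A D A (tmap eta (supid A) (tlunit_inv A a)))) = a) /\
    (forall d : D,
       tlunit D (tmap eps (supid D)
         (tassoc_inv D A D (tmap (supid D) eta (trunit_inv D d)))) = d).

Record quantale := Quantale {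
  q_sl :> suplattice;
  qmul : q_sl -> q_sl -> q_sl;
  qone : q_sl;
  qmulA : forall x y z, qmul x (qmul y z) = qmul (qmul x y) z;
  qmulC : forall x y, qmul x y = qmul y x;
  qmul1 : forall x, qmul qone x = x;
  qmul_supr : forall x S, qmul x (sup S) = sup (image (qmul x) S) }.

Arguments qmul {q} x y.
Arguments qone {q}.
Arguments qmulA {q} x y z.
Arguments qmulC {q} x y.
Arguments qmul1 {q} x.
Arguments qmul_supr {q} x S.
Notation "x ⋅ y" := (qmul x y) (at level 40, left associativity) : suplattice_scope.

Record two_sided_quantale := TwoSided {
  ts_q :> quantale;
  ts_top : @qone ts_q = top }.

(* Multiplication is then binary meet: see [frame_mul_meet]. *)
Record frame := Frame {
  fr_ts :> two_sided_quantale;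
  fr_idem : forall x : fr_ts, x ⋅ x = x }.

Lemma qmul_le {Q : quantale} (x x' y y' : Q) : x ⊑ x' -> y ⊑ y' -> x ⋅ y ⊑ x' ⋅ y'.
Proof.
have mono (a b c : Q) : b ⊑ c -> a ⋅ b ⊑ a ⋅ c.
  exact: (supmap_mono (@Supmap Q Q (qmul a) (qmul_supr a))).
move=> lx ly; apply: (le_trans (y := x ⋅ y')); first exact: mono.
by rewrite (qmulC x) (qmulC x'); exact: mono.
Qed.

Lemma qmul_sup_le {Q : quantale} (x : Q) S z :
  x ⋅ sup S ⊑ z <-> forall y, S y -> x ⋅ y ⊑ z.
Proof. by rewrite qmul_supr sup_image_le. Qed.

Lemma le_one {Q : two_sided_quantale} (x : Q) : x ⊑ qone.
Proof. by rewrite ts_top; exact: le_top. Qed.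

Lemma frame_mul_meet (A : frame) (x y z : A) : z ⊑ x ⋅ y <-> z ⊑ x /\ z ⊑ y.
Proof.
split=> [H|[zx zy]]; last by rewrite -(fr_idem z); exact: qmul_le.
have mull (a b : A) : a ⋅ b ⊑ b.
  by rewrite -{2}(qmul1 b); apply: qmul_le (le_refl _); exact: le_one.
by split; apply: le_trans H _; rewrite ?mull // qmulC.
Qed.

Record quanthom (P Q : quantale) := Quanthom {
  qh_map :> supmap P Q;
  qh_one : qh_map qone = qone;
  qh_mul : forall x y, qh_map (x ⋅ y) = qh_map x ⋅ qh_map y }.

Lemma quanthom_ext (P Q : quantale) (f g : quanthom P Q) : (forall x, f x = g x) -> f = g.
Proof.
case: f g => [f f1 fM] [g g1 gM] /= /supmap_ext E; subst g.
by rewrite (proof_irrelevance _ f1 g1) (proof_irrelevance _ fM gM).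
Qed.

Program Definition qid (Q : quantale) : quanthom Q Q := @Quanthom Q Q (supid Q) _ _.
Next Obligation. by []. Qed.
Next Obligation. by []. Qed.

Program Definition qcomp (P Q T : quantale) (g : quanthom Q T) (f : quanthom P Q) :
  quanthom P T := @Quanthom P T (supcomp g f) _ _.
Next Obligation. by move=> P Q T g f; rewrite supcompE !qh_one. Qed.
Next Obligation. by move=> P Q T g f x y; rewrite !supcompE !qh_mul. Qed.

Program Definition Omega_quantale : quantale :=
  @Quantale Omega (fun p q : Prop => p /\ q) True _ _ _ _.
Next Obligation. by move=> p q r; apply: propositional_extensionality; tauto. Qed.
Next Obligation. by move=> p q; apply: propositional_extensionality; tauto. Qed.
Next Obligation. by move=> p; apply: propositional_extensionality; tauto. Qed.
Next Obligation.
move=> p S; apply: propositional_extensionality; split.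
  by move=> [hp [q [Sq hq]]]; exists (p /\ q); split=> //; exists q.
by move=> [_ [[q Sq ->] [hp hq]]]; split=> //; exists q.
Qed.

Program Definition Omega_ts : two_sided_quantale := @TwoSided Omega_quantale _.
Next Obligation.
by apply: propositional_extensionality; split=> // _; exists True.
Qed.

Program Definition Omega_frame : frame := @Frame Omega_ts _.
Next Obligation. by move=> p; apply: propositional_extensionality; split=> [[]|]. Qed.

(* The multiplication of [P ⊕ Q] is the componentwise one ([tmul_tens]), and
   [P ⊕ Q] is the coproduct ([coprod_universal]). *)
Section CoproductMul.

Variables P Q : quantale.

Definition tmul (U V : P ⊗ Q) : P ⊗ Q :=
  sup (fun t => exists a b a' b',
    [/\ tmem U a b, tmem V a' b' & t = tens (a ⋅ a') (b ⋅ b')]).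

Lemma tmul_le (U V W : P ⊗ Q) :
  tmul U V ⊑ W <->
  forall a b a' b', tmem U a b -> tmem V a' b' -> tmem W (a ⋅ a') (b ⋅ b').
Proof.
rewrite sup_le; split=> [H a b a' b' Uab Vab|H t [a [b [a' [b' [Uab Vab ->]]]]]].
  by apply/tens_le/H; exists a, b, a', b'.
by apply/tens_le; apply: H.
Qed.

Lemma tmul_closed (W : P ⊗ Q) a b : tclosed (fun x y => tmem W (a ⋅ x) (b ⋅ y)).
Proof.
split=> [x y x' y' H lx ly|S y H|x S H].
- by apply: tmem_le H _ _; apply: qmul_le => //; apply: le_refl.
- by rewrite qmul_supr; apply: tmem_supl => _ [x Sx ->]; apply: H.
- by rewrite qmul_supr; apply: tmem_supr => _ [y Sy ->]; apply: H.
Qed.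

Lemma mem_le (U V : P ⊗ Q) a b : U ⊑ V -> tmem U a b -> tmem V a b.
Proof. by apply. Qed.

Lemma tmulC U V : tmul U V = tmul V U.
Proof.
by apply: eq_by_ub => W; rewrite !tmul_le; split=> H a b a' b' ? ?;
   rewrite (qmulC a) (qmulC b); apply: H.
Qed.

Lemma tmul_leP (U V W : P ⊗ Q) :
  tmul U V ⊑ W <-> forall a b, tmem U a b -> V ⊑ exist _ _ (tmul_closed W a b).
Proof.
rewrite tmul_le; split=> [H a b Uab x y Vxy|H a b a' b' Uab Vab]; first exact: H.
exact: (mem_le (H a b Uab) Vab).
Qed.

Lemma tmul_supr U F : tmul U (sup F) = sup (image (tmul U) F).
Proof.
apply: eq_by_ub => W; rewrite sup_image_le tmul_leP.
split=> [H V FV|H a b Uab]; last first.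
  by apply/sup_le => V FV; move/tmul_leP: (H V FV); apply.
by apply/tmul_leP => a b Uab; apply: le_trans (H a b Uab); apply: sup_ub.
Qed.

Lemma tmul_tens_le a b V W :
  tmul (tens a b) V ⊑ W <-> V ⊑ exist _ _ (tmul_closed W a b).
Proof.
rewrite tmulC tmul_leP; split=> H x y Vxy.
  by move/tens_le: (H x y Vxy); rewrite /tmem /= (qmulC a) (qmulC b).
by apply/tens_le; move: (H x y Vxy); rewrite /tmem /= (qmulC a) (qmulC b).
Qed.

Lemma tmul_tens a b a' b' : tmul (tens a b) (tens a' b') = tens (a ⋅ a') (b ⋅ b').
Proof. by apply: eq_by_ub => W; rewrite tmul_tens_le !tens_le. Qed.

Lemma tmulA U V W : tmul U (tmul V W) = tmul (tmul U V) W.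
Proof.
apply: eq_by_ub => X; rewrite (tmulC (tmul U V)) (tmul_leP U) (tmul_leP W).
split=> H.
  move=> c d Wcd; apply/tmul_le => a b a' b' Uab Vab; rewrite /tmem /=.
  move/tmul_le: (H a b Uab) => /(_ _ _ _ _ Vab Wcd); rewrite /tmem /=.
  by rewrite !qmulA (qmulC _ c) (qmulC _ d) !qmulA.
move=> a b Uab; apply/tmul_le => a' b' c d Vab Wcd; rewrite /tmem /=.
move/tmul_le: (H c d Wcd) => /(_ _ _ _ _ Uab Vab); rewrite /tmem /=.
by rewrite (qmulC c) (qmulC d) -!qmulA.
Qed.

Lemma tmul1 U : tmul (tens qone qone) U = U.
Proof.
apply: eq_by_ub => W; rewrite tmul_tens_le.
by split=> H a b /H; rewrite /tmem /= !qmul1.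
Qed.

Definition coprod_quantale : quantale :=
  @Quantale (P ⊗ Q) tmul (tens qone qone) tmulA tmulC tmul1 tmul_supr.

End CoproductMul.

Program Definition coprod (P Q : two_sided_quantale) : two_sided_quantale :=
  @TwoSided (coprod_quantale P Q) _.
Next Obligation.
move=> P Q; apply: le_antisym; first exact: le_top.
move=> a b _; apply/tens_le; apply: tens_mono; exact: le_one.
Qed.

Notation "P ⊕ Q" := (coprod P Q) (at level 50, left associativity) : suplattice_scope.

Program Definition coprod_frame (A B : frame) : frame := @Frame (A ⊕ B) _.
Next Obligation.
move=> A B U; apply: le_antisym.
  move: (le_one U) => H; apply: le_trans (qmul_le H (le_refl U)) _.
  by rewrite qmul1; apply: le_refl.
rewrite {1}[U]tensor_gen; apply/tensor_sup_le => a b Uab.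
move: (le_refl (U ⋅ U)) => /tmul_le /(_ a b a b Uab Uab).
by rewrite !fr_idem.
Qed.

Section CoproductMaps.

Variables P Q : two_sided_quantale.

Program Definition inj1 : quanthom P (P ⊕ Q) :=
  @Quanthom P (P ⊕ Q) (bm_left (tens_bimap P Q) qone) _ _.
Next Obligation. by []. Qed.
Next Obligation. by move=> x y; rewrite /= tmul_tens qmul1. Qed.

Program Definition inj2 : quanthom Q (P ⊕ Q) :=
  @Quanthom Q (P ⊕ Q) (bm_right (tens_bimap P Q) qone) _ _.
Next Obligation. by []. Qed.
Next Obligation. by move=> x y; rewrite /= tmul_tens qmul1. Qed.

Variable T : two_sided_quantale.
Variables (f : quanthom P T) (g : quanthom Q T).

Program Definition copair_bimap : bimap P Q T := @Bimap P Q T (fun a b => f a ⋅ g b) _ _.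
Next Obligation.
move=> S b; apply: eq_by_ub => z; rewrite sm_sup qmulC qmul_sup_le sup_image_le.
split=> [H a Sa|H _ [a Sa ->]]; last by rewrite qmulC; apply: H.
by rewrite qmulC; apply: H; exists a.
Qed.
Next Obligation.
move=> a S; apply: eq_by_ub => z; rewrite sm_sup qmul_sup_le sup_image_le.
split=> [H b Sb|H _ [b Sb ->]]; last exact: H.
by apply: H; exists b.
Qed.

Program Definition copair : quanthom (P ⊕ Q) T := @Quanthom (P ⊕ Q) T (tlift copair_bimap) _ _.
Next Obligation. by rewrite tlift_tens /= !qh_one qmul1. Qed.
Next Obligation.
have tensM (a a' : P) (b b' : Q) :
    f (a ⋅ a') ⋅ g (b ⋅ b') = (f a ⋅ g b) ⋅ (f a' ⋅ g b').
  rewrite !qh_mul !qmulA; congr (_ ⋅ _); rewrite -!qmulA; congr (_ ⋅ _); exact: qmulC.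
move=> U V; apply: le_antisym.
  apply/(supmap_sup_le (tlift copair_bimap)) => _ [a [b [a' [b' [Uab Vab ->]]]]].
  rewrite tlift_tens /= tensM; apply: qmul_le; apply: sup_ub; [by exists a, b|by exists a', b'].
apply/qmul_sup_le => _ [a' [b' [Vab ->]]]; rewrite qmulC.
apply/qmul_sup_le => _ [a [b [Uab ->]]]; rewrite qmulC -tensM.
rewrite -[f _ ⋅ g _]/(copair_bimap _ _) -tlift_tens.
by apply: supmap_mono; apply/tens_le; move/tmul_le: (le_refl (tmul U V)); apply.
Qed.

Lemma copair_tens a b : copair (tens a b) = f a ⋅ g b.
Proof. exact: (tlift_tens copair_bimap). Qed.

Lemma coprod_universal :
  exists! h : quanthom (P ⊕ Q) T, qcomp h inj1 = f /\ qcomp h inj2 = g.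
Proof.
exists copair; split.
  split; apply: quanthom_ext => x; rewrite /= -[LHS]/(copair (tens _ _)) copair_tens qh_one.
    by rewrite qmulC qmul1.
  by rewrite qmul1.
move=> h [E1 E2]; apply: quanthom_ext => U.
suff -> : qh_map copair = qh_map h by [].
apply: tensor_ext => a b; rewrite copair_tens -E1 -E2.
rewrite -[RHS]/(h (tens a b)) -[qcomp h _ a]/(h (tens a qone)) -[qcomp h _ b]/(h (tens qone b)).
by rewrite -qh_mul /= tmul_tens qmul1 qmulC qmul1.
Qed.

End CoproductMaps.

Program Definition oplus (P Q P' Q' : two_sided_quantale) (f : quanthom P P')
    (g : quanthom Q Q') : quanthom (P ⊕ Q) (P' ⊕ Q') :=
  @Quanthom (P ⊕ Q) (P' ⊕ Q') (tmap f g) _ _.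
Next Obligation. by move=> P Q P' Q' f g; rewrite tmap_tens !qh_one. Qed.
Next Obligation.
move=> P Q P' Q' f g.
suff -> : tmap f g = copair (qcomp (inj1 P' Q') f) (qcomp (inj2 P' Q') g) by exact: qh_mul.
apply: tensor_ext => a b; rewrite tmap_tens copair_tens /= tmul_tens.
by rewrite qmul1 qmulC qmul1.
Qed.

Lemma oplus_comp (A B C A' B' C' : two_sided_quantale) (f : quanthom A B) (g : quanthom B C)
    (f' : quanthom A' B') (g' : quanthom B' C') x :
  oplus (qcomp g f) (qcomp g' f') x = oplus g g' (oplus f f' x).
Proof. exact: (f_equal (fun h : supmap _ _ => h x) (tmap_comp f g f' g')). Qed.

Lemma oplus_id (A B : two_sided_quantale) x : oplus (qid A) (qid B) x = x.
Proof. exact: (f_equal (fun h : supmap _ _ => h x) (tmap_id A B)). Qed.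

Program Definition bang (Q : two_sided_quantale) : quanthom Omega_ts Q :=
  @Quanthom Omega_ts Q (bm_left (tlunit_bimap Q) qone) _ _.
Next Obligation. by move=> Q; exact: restrictT. Qed.
Next Obligation.
move=> Q p q; change (restrict (p /\ q) (@qone Q) = restrict p qone ⋅ restrict q qone).
apply: eq_by_ub => z; rewrite restrict_le qmul_sup_le.
split=> [H _ [-> hq]|H [hp hq]].
  by rewrite qmulC qmul1; apply/restrict_le => hp; apply: H.
by move: (H _ (conj eq_refl hq)); rewrite qmulC qmul1 => /restrict_le; apply.
Qed.

(* A frame map [A -> L] is a generalised point of the locale with frame [A], at
   the stage given by the locale with frame [L].  [gconst] and [gop] are the
   constants and operations which maps out of [1] and [X × X] induce on such
   points. *)
Definition gconst {A L : frame} (e : quanthom A Omega_frame) : quanthom A L :=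
  qcomp (bang L) e.

Definition gop {A L : frame} (m : quanthom A (coprod_frame A A)) (f g : quanthom A L) :
  quanthom A L := qcomp (copair f g) m.

(* The semiring axioms are imposed on generalised points at every stage, i.e.
   [Loc(Y, R)] is a commutative semiring for every locale [Y]. *)
Record localic_semiring := LocalicSemiring {
  ls_opens :> frame;
  eps0 : quanthom ls_opens Omega_frame;
  eps1 : quanthom ls_opens Omega_frame;
  mu_add : quanthom ls_opens (coprod_frame ls_opens ls_opens);
  mu_mul : quanthom ls_opens (coprod_frame ls_opens ls_opens);
  ls_semiring : forall L : frame,
    semi_ring_theory (@gconst ls_opens L eps0) (gconst eps1) (gop mu_add) (gop mu_mul) eq }.

(* The left adjoint is to the unique frame map [bang : Omega -> A]. *)
Definition overt (A : frame) : Prop :=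
  exists pos : A -> Prop, forall (a : A) (p : Prop), (pos a -> p) <-> a ⊑ bang A p.

Program Definition saturated (R : localic_semiring) : suplattice :=
  @Suplattice {s : R | mu_mul R s ⊑ inj1 R R s}
    (fun s t => proj1_sig s ⊑ proj1_sig t)
    (fun F => exist _ (sup (image (@proj1_sig _ _) F)) _) _ _ _ _.
Next Obligation.
move=> R F; apply/supmap_sup_le => _ [s Fs ->]; apply: le_trans (proj2_sig s) _.
by apply: supmap_mono; apply: sup_ub; exists s.
Qed.
Next Obligation. by move=> R s; apply: le_refl. Qed.
Next Obligation. by move=> R s t w; apply: le_trans. Qed.
Next Obligation. by move=> R s t st ts; apply: sig_ext; apply: le_antisym. Qed.
Next Obligation. by move=> R F s /=; rewrite sup_image_le. Qed.

Definition approximable (R : localic_semiring) : Prop := overt R /\ dualisable (saturated R).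

Record category := Category {
  obj :> Type;
  mor : obj -> obj -> Type;
  idm : forall a, mor a a;
  cmp : forall a b c, mor b c -> mor a b -> mor a c;
  cmp1m : forall a b (f : mor a b), cmp (idm b) f = f;
  cmpm1 : forall a b (f : mor a b), cmp f (idm a) = f;
  cmpA : forall a b c d (h : mor c d) (g : mor b c) (f : mor a b),
    cmp h (cmp g f) = cmp (cmp h g) f }.

Arguments mor {_} _ _.
Arguments idm {_} _.
Arguments cmp {_} {_ _ _} _ _.

Definition opposite (C : category) : category :=
  @Category C (fun a b => mor b a) (fun a => idm a) (fun a b c g f => cmp f g)
    (fun a b f => cmpm1 f) (fun a b f => cmp1m f)
    (fun a b c d h g f => eq_sym (cmpA f g h)).

Record set_functor (C : category) := SetFunctor {
  sf_obj :> C -> Type;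
  sf_map : forall a b, mor a b -> sf_obj a -> sf_obj b;
  sf_id : forall a x, sf_map (idm a) x = x;
  sf_cmp : forall a b c (g : mor b c) (f : mor a b) x,
    sf_map (cmp g f) x = sf_map g (sf_map f x) }.

Arguments sf_map {_} _ {_ _} _ _.

Definition represents (C : category) (F : set_functor C) (A : C) : Prop :=
  exists (phi : forall B, mor A B -> F B) (psi : forall B, F B -> mor A B),
    [/\ forall B B' (h : mor B B') (g : mor A B), phi B' (cmp h g) = sf_map F h (phi B g),
        forall B (g : mor A B), psi B (phi B g) = g
      & forall B (v : F B), phi B (psi B v) = v].

Program Definition Quant_top : category :=
  @Category two_sided_quantale (fun P Q => quanthom P Q) (fun Q => qid Q)
    (fun P Q T g f => qcomp g f) _ _ _.
Next Obligation. by move=> P Q f; apply: quanthom_ext. Qed.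
Next Obligation. by move=> P Q f; apply: quanthom_ext. Qed.
Next Obligation. by move=> P Q T S h g f; apply: quanthom_ext. Qed.

Program Definition Frm : category :=
  @Category frame (fun P Q => quanthom P Q) (fun Q => qid Q) (fun P Q T g f => qcomp g f) _ _ _.
Next Obligation. by move=> P Q f; apply: quanthom_ext. Qed.
Next Obligation. by move=> P Q f; apply: quanthom_ext. Qed.
Next Obligation. by move=> P Q T S h g f; apply: quanthom_ext. Qed.

Definition Loc : category := opposite Frm.

Section OPAI.

Variable R : localic_semiring.

Definition is_opai (Q : two_sided_quantale) (u : Q ⊕ R) : Prop :=
  [/\ oplus (qid Q) (eps0 R) u = bot,
      oplus (qid Q) (eps1 R) u = qone,
      oplus (qid Q) (mu_add R) u ⊑
        oplus (qid Q) (inj1 R R) u ⊔ oplus (qid Q) (inj2 R R) u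
    & oplus (qid Q) (mu_mul R) u =
        oplus (qid Q) (inj1 R R) u ⋅ oplus (qid Q) (inj2 R R) u].

Lemma oplus_swap (P Q A B : two_sided_quantale) (g : quanthom P Q) (f : quanthom A B) x :
  oplus (qid Q) f (oplus g (qid A) x) = oplus g (qid B) (oplus (qid P) f x).
Proof.
rewrite -!oplus_comp; suff -> : qcomp (qid Q) g = qcomp g (qid P).
  by congr (oplus _ _ x); apply: quanthom_ext.
exact: quanthom_ext.
Qed.

Lemma opai_map (P Q : two_sided_quantale) (g : quanthom P Q) u :
  is_opai (Q := P) u -> is_opai (Q := Q) (oplus g (qid R) u).
Proof.
move=> [H0 H1 Ha Hm]; split.
- by rewrite oplus_swap H0 supmap_bot.
- by rewrite oplus_swap H1 qh_one.
- by rewrite !oplus_swap -supmap_join; apply: supmap_mono.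
- by rewrite !oplus_swap Hm qh_mul.
Qed.

Program Definition OPAI_bar : set_functor Quant_top :=
  @SetFunctor Quant_top (fun Q => {u : Q ⊕ R | is_opai u})
    (fun P Q g u => exist _ (oplus g (qid R) (proj1_sig u)) (opai_map g (proj2_sig u))) _ _.
Next Obligation. by move=> Q u; apply: sig_ext; exact: (oplus_id (A := Q)). Qed.
Next Obligation.
move=> P Q T g f u; apply: sig_ext.
have E : qcomp (qid R) (qid R) = qid R by apply: quanthom_ext.
by move: (oplus_comp f g (qid R) (qid R) (proj1_sig u)); rewrite E.
Qed.

Program Definition OPAI : set_functor (opposite Loc) :=
  @SetFunctor (opposite Loc) (fun X : frame => OPAI_bar X)
    (fun (X Y : frame) (g : quanthom X Y) u => sf_map OPAI_bar (a := X) (b := Y) g u) _ _.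
Next Obligation. by move=> X u; exact: (sf_id (s := OPAI_bar)). Qed.
Next Obligation. by move=> X Y Z g f u; exact: (sf_cmp (s := OPAI_bar)). Qed.

Definition is_quantic_spectrum (Q : two_sided_quantale) : Prop :=
  represents (C := Quant_top) OPAI_bar Q.

(* Here and in [Loc], a locale is given by its frame of opens. *)
Definition is_localic_spectrum (X : frame) : Prop :=
  represents (C := opposite Loc) OPAI X.

End OPAI.

(* [semi_ring_theory] axiomatises commutative semirings. *)
Record semiring := Semiring {
  sr_car :> Type;
  s0 : sr_car;
  s1 : sr_car;
  sadd : sr_car -> sr_car -> sr_car;
  smul : sr_car -> sr_car -> sr_car;
  sr_theory : semi_ring_theory s0 s1 sadd smul eq }.

Program Definition powerset_sl (X : Type) : suplattice :=
  @Suplattice (X -> Prop) (fun U V => forall x, U x -> V x)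
    (fun F x => exists2 U, F U & U x) _ _ _ _.
Next Obligation. by []. Qed.
Next Obligation. by move=> X U V W UV VW x /UV/VW. Qed.
Next Obligation. by move=> X U V UV VU; apply: predext => x; split; [apply: UV|apply: VU]. Qed.
Next Obligation.
move=> X F V; split=> [H U FU x Ux|H x [U FU Ux]]; last exact: H FU _ Ux.
by apply: H; exists U.
Qed.

Program Definition powerset_quantale (X : Type) : quantale :=
  @Quantale (powerset_sl X) (fun U V x => U x /\ V x) (fun _ => True) _ _ _ _.
Next Obligation. by move=> X U V W; apply: predext => x; tauto. Qed.
Next Obligation. by move=> X U V; apply: predext => x; tauto. Qed.
Next Obligation. by move=> X U; apply: predext => x; tauto. Qed.
Next Obligation.
move=> X U F; apply: predext => x; split.
  by move=> [Ux [V FV Vx]]; exists (fun x => U x /\ V x) => //; exists V.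
by move=> [_ [V FV ->] [Ux Vx]]; split=> //; exists V.
Qed.

Program Definition powerset_ts (X : Type) : two_sided_quantale := @TwoSided (powerset_quantale X) _.
Next Obligation. by move=> X; apply: predext => x; split=> // _; exists (fun _ => True). Qed.

Program Definition discrete (X : Type) : frame := @Frame (powerset_ts X) _.
Next Obligation. by move=> X U; apply: predext => x; split=> [[]|]. Qed.

Program Definition preimage (X Y : Type) (f : X -> Y) : quanthom (discrete Y) (discrete X) :=
  @Quanthom (discrete Y) (discrete X)
    (@Supmap (discrete Y) (discrete X) (fun V x => V (f x)) _) _ _.
Next Obligation.
move=> X Y f F; apply: predext => x; split=> [[V FV Vfx]|[_ [V FV ->] Vfx]].
  by exists (fun x => V (f x)) => //; exists V.
by exists V.
Qed.
Next Obligation. by []. Qed.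
Next Obligation. by []. Qed.

Program Definition discrete_point (X : Type) (x : X) : quanthom (discrete X) Omega_frame :=
  @Quanthom (discrete X) Omega_frame (@Supmap (discrete X) Omega_frame (fun U => U x) _) _ _.
Next Obligation.
move=> X x F; apply: propositional_extensionality; split=> [[U FU Ux]|[_ [[U FU ->] Ux]]].
  by exists (U x); split=> //; exists U.
by exists U.
Qed.
Next Obligation. by []. Qed.
Next Obligation. by []. Qed.

Definition single {X : Type} (x : X) : discrete X := fun y => y = x.

Lemma single_le {X : Type} (x : X) (U : discrete X) : single x ⊑ U <-> U x.
Proof. by split=> [|Ux y ->] //; apply. Qed.

Lemma discrete_gen {X : Type} (U : discrete X) : U = sup (image single U).
Proof. by apply: (@eq_by_ub (discrete X)) => V; rewrite sup_image_le; split=> H x /H /single_le. Qed.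

Lemma single_mul_le {X : Type} (x y : X) (U : discrete X) :
  (x = y -> single x ⊑ U) -> single x ⋅ single y ⊑ U.
Proof. by move=> H z [zx zy]; apply: H => //; rewrite -zx -zy. Qed.

(* The canonical map from the opens of the discrete product to the coproduct of
   frames is an isomorphism: see [discrete_prodK]. *)
Program Definition discrete_prod (X Y : Type) :
    quanthom (discrete (X * Y)) (coprod_frame (discrete X) (discrete Y)) :=
  @Quanthom (discrete (X * Y)) (coprod_frame (discrete X) (discrete Y))
    (@Supmap (discrete (X * Y)) (coprod_frame (discrete X) (discrete Y))
      (fun W => sup (fun t => exists x y, W (x, y) /\ t = tens (single x) (single y))) _) _ _.
Next Obligation.
move=> X Y F; apply: (@eq_by_ub (coprod_frame (discrete X) (discrete Y))) => V.
rewrite sup_image_le sup_le; split=> [H W FW|H t [x [y [[W FW Wxy] ->]]]].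
  by apply/sup_le => t [x [y [Wxy ->]]]; apply: H; exists x, y; split=> //; exists W.
by move/sup_le: (H W FW); apply; exists x, y.
Qed.
Next Obligation.
move=> X Y; apply: (@le_antisym (coprod_frame (discrete X) (discrete Y))); first exact: le_one.
apply/tens_le; apply: (tmem_le (A := discrete X) (B := discrete Y)
  (a := sup (image single (fun _ => True))) (b := sup (image single (fun _ => True)))).
- apply: tmem_supl => _ [x _ ->]; apply: tmem_supr => _ [y _ ->].
  by apply/tens_le; apply: sup_ub; exists x, y.
- by rewrite -discrete_gen.
- by rewrite -discrete_gen.
Qed.
Next Obligation.
move=> X Y U V; set T := coprod_frame _ _.
apply: (@le_antisym T).
  apply/(sup_le (s := T)) => _ [x [y [[Uxy Vxy] ->]]].
  rewrite -(fr_idem (tens _ _ : T)).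
  by apply: qmul_le; apply: sup_ub; exists x, y.
apply/(qmul_sup_le (Q := T)) => _ [x' [y' [V' ->]]]; rewrite qmulC.
apply/(qmul_sup_le (Q := T)) => _ [x [y [Uxy ->]]].
rewrite [_ ⋅ _]tmul_tens.
apply/tens_le.
have mulE (Z : Type) (z w : Z) : single z ⋅ single w = sup (fun S => S = single w /\ z = w).
  apply: (@eq_by_ub (discrete Z)) => S; rewrite sup_le; split=> H.
    by move=> _ [-> zw]; apply: le_trans H => t ->; rewrite zw.
  by move=> t [tz tw]; apply: (H (single w)); [split=> //; rewrite -tz -tw|].
rewrite !mulE; apply: tmem_supl => _ [-> E1]; apply: tmem_supr => _ [-> E2].
apply/tens_le; apply: sup_ub; exists x, y; split=> //.
by split=> //; rewrite -E1 -E2.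
Qed.

Lemma discrete_hom_le (X : Type) (Q : quantale) (f : quanthom (discrete X) Q) U z :
  f U ⊑ z <-> forall x, U x -> f (single x) ⊑ z.
Proof.
rewrite [in f U](discrete_gen U) supmap_sup_le.
by split=> [H x Ux|H _ [x Ux ->]]; [apply: H; exists x|apply: H].
Qed.

Lemma copair_discrete_le (X Y : Type) (Q : two_sided_quantale)
    (f : quanthom (discrete X) Q) (g : quanthom (discrete Y) Q) W z :
  copair f g (discrete_prod X Y W) ⊑ z <->
  forall x y, W (x, y) -> f (single x) ⋅ g (single y) ⊑ z.
Proof.
rewrite -[discrete_prod X Y W]/(sup _) supmap_sup_le.
split=> [H x y Wxy|H _ [x [y [Wxy ->]]]]; last by rewrite copair_tens; apply: H.
by rewrite -copair_tens; apply: H; exists x, y.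
Qed.

Lemma discrete_prodK (X Y : Type) :
  let inv := copair (preimage (@fst X Y)) (preimage (@snd X Y)) in
  qcomp inv (discrete_prod X Y) = qid _ /\ qcomp (discrete_prod X Y) inv = qid _.
Proof.
move=> inv; split; apply: quanthom_ext => W.
  apply: (@eq_by_ub (discrete (X * Y))) => V; rewrite [qcomp _ _ _]/(inv _) copair_discrete_le.
  split=> [H [x y] Wxy|H x y Wxy [x' y'] [/= -> ->]]; last exact: H.
  by apply: (H x y).
suff -> : qh_map (qcomp (discrete_prod X Y) inv) = qh_map (qid _) by [].
apply: (@tensor_ext (discrete X) (discrete Y)) => U V; rewrite supcompE copair_tens.
apply: eq_by_ub => T; rewrite [X in _ <-> X]tens_le sup_le.
split=> [H|H t [x [y [[Ux Vy] ->]]]]; last first.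
  by apply/tens_le; apply: tmem_le H _ _; apply/single_le.
rewrite (discrete_gen U) (discrete_gen V).
apply: tmem_supl => _ [x Ux ->]; apply: tmem_supr => _ [y Vy ->].
by apply/tens_le; apply: H; exists x, y.
Qed.

Definition discrete_op (X : Type) (op : X -> X -> X) :
    quanthom (discrete X) (coprod_frame (discrete X) (discrete X)) :=
  qcomp (discrete_prod X X) (preimage (fun p : X * X => op p.1 p.2)).

Lemma gop_discrete_le (X : Type) (op : X -> X -> X) (L : frame)
    (f g : quanthom (discrete X) L) U z :
  gop (discrete_op op) f g U ⊑ z <->
  forall x y, U (op x y) -> f (single x) ⋅ g (single y) ⊑ z.
Proof. exact: (copair_discrete_le f g (preimage _ U)). Qed.

Lemma gconst_discrete_le (X : Type) (c : X) (L : frame) U (z : L) :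
  gconst (discrete_point c) U ⊑ z <-> (U c -> qone ⊑ z).
Proof. exact: restrict_le. Qed.

Lemma gconst_mul_le (X : Type) (c : X) (L : frame) U (w z : L) :
  gconst (discrete_point c) U ⋅ w ⊑ z <-> (U c -> w ⊑ z).
Proof.
rewrite qmulC [gconst _ _]/(restrict _ _) qmul_sup_le.
by split=> [H Uc|H _ [-> Uc]]; [rewrite -(qmul1 w) qmulC; apply: H|rewrite qmulC qmul1; apply: H].
Qed.

Lemma qmul_res {Q : quantale} (x y z : Q) : x ⋅ y ⊑ z <-> y ⊑ sup (fun t => x ⋅ t ⊑ z).
Proof.
split=> H; first exact: sup_ub.
by apply: le_trans (qmul_le (le_refl x) H) _; apply/qmul_sup_le.
Qed.

Lemma discrete_hom_single_le (X : Type) (Q : quantale) (h : quanthom (discrete X) Q) c d w z :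
  (c = d -> h (single c) ⋅ w ⊑ z) -> h (single c) ⋅ h (single d) ⋅ w ⊑ z.
Proof.
move=> H; rewrite -qh_mul qmulC; apply/qmul_res; apply/discrete_hom_le => e [ec ed].
by apply/qmul_res; rewrite qmulC ec; apply: H; rewrite -ec -ed.
Qed.

Lemma gop_discrete_mul_le (X : Type) (op : X -> X -> X) (L : frame)
    (f g : quanthom (discrete X) L) U w z :
  gop (discrete_op op) f g U ⋅ w ⊑ z <->
  forall x y, U (op x y) -> f (single x) ⋅ g (single y) ⋅ w ⊑ z.
Proof.
rewrite qmulC qmul_res gop_discrete_le.
split=> H x y /H K; first by rewrite qmulC; apply/(qmul_res w).
by apply/(qmul_res w); rewrite qmulC.
Qed.

Lemma discrete_semiring_theory (R : semiring) (L : frame) :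
  semi_ring_theory (gconst (L := L) (discrete_point (s0 R))) (gconst (discrete_point (s1 R)))
    (gop (discrete_op (@sadd R))) (gop (discrete_op (@smul R))) eq.
Proof.
have [add0 addC addA mul1 mul0 mulC mulA distr] := sr_theory R.
have opC (op : R -> R -> R) : (forall x y, op x y = op y x) ->
    forall f g : quanthom (discrete R) L, gop (discrete_op op) f g = gop (discrete_op op) g f.
  move=> C f g; apply: quanthom_ext => U; apply: eq_by_ub => z; rewrite !gop_discrete_le.
  by split=> H x y; rewrite C => /H; rewrite qmulC.
have opA (op : R -> R -> R) : (forall x y z, op x (op y z) = op (op x y) z) ->
    forall f g h : quanthom (discrete R) L,
    gop (discrete_op op) f (gop (discrete_op op) g h) =
    gop (discrete_op op) (gop (discrete_op op) f g) h.
  move=> A f g h; apply: quanthom_ext => U; apply: eq_by_ub => z; rewrite !gop_discrete_le.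
  split=> H x y Uxy.
    apply/gop_discrete_mul_le => a b Ex; rewrite -qmulA qmulC.
    have {}Ex : op a b = x by []. rewrite -Ex -A in Uxy.
    rewrite qmulC; move: (H a _ Uxy); rewrite qmulC => /gop_discrete_mul_le K.
    by rewrite qmulC; apply: K.
  rewrite qmulC; apply/gop_discrete_mul_le => b c Ey.
  have {}Ey : op b c = y by []. rewrite -Ey A in Uxy.
  by rewrite qmulC qmulA; move/gop_discrete_mul_le: (H _ _ Uxy); apply.
have op1 (op : R -> R -> R) e : (forall x, op e x = x) ->
    forall f : quanthom (discrete R) L, gop (discrete_op op) (gconst (discrete_point e)) f = f.
  move=> op1 f; apply: quanthom_ext => U; apply: eq_by_ub => z.
  rewrite gop_discrete_le discrete_hom_le; split=> [H x Ux|H x y Uxy].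
    by move: (H e x); rewrite op1 => /(_ Ux)/gconst_mul_le; apply.
  by apply/gconst_mul_le => E; apply: H; rewrite -(op1 y) E.
split; [exact: op1|exact: opC|exact: opA|exact: op1| |exact: opC|exact: opA|].
  move=> f; apply: quanthom_ext => U; apply: eq_by_ub => z.
  rewrite gop_discrete_le gconst_discrete_le; split=> [H U0|H x y Uxy].
    rewrite -(qh_one f); apply/discrete_hom_le => y _.
    by move: (H (s0 R) y); rewrite mul0 => /(_ U0)/gconst_mul_le; apply.
  apply/gconst_mul_le => E; apply: le_trans (le_one _) (H _).
  by rewrite -(mul0 y) E.
move=> f g h; apply: quanthom_ext => U; apply: eq_by_ub => z; rewrite !gop_discrete_le.
split=> H x y Uxy.
  apply/gop_discrete_mul_le => a c Ex; rewrite qmulC.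
  apply/gop_discrete_mul_le => b d Ey.
  have {}Ex : smul a c = x by []. have {}Ey : smul b d = y by [].
  have -> : g (single b) ⋅ h (single d) ⋅ (f (single a) ⋅ h (single c)) =
      h (single c) ⋅ h (single d) ⋅ (f (single a) ⋅ g (single b)).
    rewrite qmulC (qmulC (f _)) -!qmulA; congr (_ ⋅ _).
    by rewrite (qmulC (g _)) !qmulA (qmulC (f _)).
  apply: discrete_hom_single_le => E; rewrite qmulC; subst d.
  by move: (H (sadd a b) c); rewrite distr Ex Ey => /(_ Uxy)/gop_discrete_mul_le; apply.
apply/gop_discrete_mul_le => a b E; have {}E : sadd a b = x by [].
move: (H (smul a y) (smul b y)); rewrite -distr E => /(_ Uxy)/gop_discrete_mul_le.
move=> /(_ a y eq_refl); rewrite qmulC => /gop_discrete_mul_le /(_ b y eq_refl).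
rewrite -{3}(fr_idem (h (single y))) => K; apply: le_trans K.
have -> : f (single a) ⋅ g (single b) ⋅ (h (single y) ⋅ h (single y)) =
    g (single b) ⋅ h (single y) ⋅ (f (single a) ⋅ h (single y)).
  rewrite (qmulC (f _)) -!qmulA; congr (_ ⋅ _).
  by rewrite !qmulA (qmulC (f _)).
exact: le_refl.
Qed.

Definition discrete_semiring (R : semiring) : localic_semiring :=
  @LocalicSemiring (discrete R) (discrete_point (s0 R)) (discrete_point (s1 R))
    (discrete_op (@sadd R)) (discrete_op (@smul R)) (@discrete_semiring_theory R).

Section Ideals.

Variable R : semiring.

Definition is_ideal (I : R -> Prop) : Prop :=
  [/\ I (s0 R), forall a b, I a -> I b -> I (sadd a b) & forall r a, I a -> I (smul r a)].

Definition ideal := {I : R -> Prop | is_ideal I}.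

Definition imem (I : ideal) : R -> Prop := proj1_sig I.

Program Definition span (S : R -> Prop) : ideal :=
  exist _ (fun a => forall I : ideal, (forall x, S x -> imem I x) -> imem I a) _.
Next Obligation.
move=> S; split=> [I _|a b Ha Hb I SI|r a Ha I SI]; case: (proj2_sig I) => [I0 Ia Im].
- exact: I0.
- by apply: Ia; [apply: Ha|apply: Hb].
- by apply: Im; apply: Ha.
Qed.

Lemma span_le S (I : ideal) : (forall x, imem (span S) x -> imem I x) <-> forall x, S x -> imem I x.
Proof. by split=> [H x Sx|H x]; [apply: H => J; apply|apply]. Qed.

Program Definition ideal_sl : suplattice :=
  @Suplattice ideal (fun I J => forall x, imem I x -> imem J x)
    (fun F => span (fun x => exists2 I, F I & imem I x)) _ _ _ _.
Next Obligation. by []. Qed.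
Next Obligation. by move=> I J K IJ JK x /IJ/JK. Qed.
Next Obligation.
by move=> I J IJ JI; apply: sig_ext; apply: predext => x; split; [apply: IJ|apply: JI].
Qed.
Next Obligation.
move=> F J; apply: iff_trans (span_le _ _) _; split=> [H I FI x Ix|H x [I FI Ix]]; last exact: H FI x Ix.
by apply: H; exists I.
Qed.

Definition ideal_mul (I J : ideal_sl) : ideal_sl :=
  span (fun x => exists i j, [/\ imem I i, imem J j & x = smul i j]).

Lemma ideal_mul_le (I J K : ideal_sl) :
  ideal_mul I J ⊑ K <-> forall i j, imem I i -> imem J j -> imem K (smul i j).
Proof.
apply: iff_trans (span_le _ _) _; split=> [H i j Ii Jj|H x [i [j [Ii Jj ->]]]]; last exact: H.
by apply: H; exists i, j.
Qed.

Lemma smulC_ (a b : R) : smul a b = smul b a.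
Proof. exact: (SRmul_comm (sr_theory R)). Qed.

Lemma smulA_ (a b c : R) : smul a (smul b c) = smul (smul a b) c.
Proof. exact: (SRmul_assoc (sr_theory R)). Qed.

Lemma ideal_mulC (I J : ideal_sl) : ideal_mul I J = ideal_mul J I.
Proof. by apply: eq_by_ub => K; rewrite !ideal_mul_le; split=> H i j *; rewrite smulC_; apply: H. Qed.

Program Definition ideal_quotient (K : ideal) (a : R) : ideal :=
  exist _ (fun x => imem K (smul a x)) _.
Next Obligation.
move=> K a; case: (proj2_sig K) => [K0 Ka Km]; split=> [|x y Kx Ky|r x Kx].
- by rewrite smulC_ (SRmul_0_l (sr_theory R)).
- by rewrite smulC_ (SRdistr_l (sr_theory R)) -!(smulC_ a); apply: Ka.
- by rewrite smulA_ (smulC_ a) -smulA_; apply: Km.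
Qed.

Lemma ideal_mul_leP (I J K : ideal_sl) :
  ideal_mul I J ⊑ K <-> forall i, imem I i -> J ⊑ (ideal_quotient K i : ideal_sl).
Proof. by rewrite ideal_mul_le; split=> H i; [move=> Ii j Jj; apply: H|move=> j Ii; apply: H]. Qed.

Lemma ideal_mulA (I J K : ideal_sl) : ideal_mul I (ideal_mul J K) = ideal_mul (ideal_mul I J) K.
Proof.
apply: eq_by_ub => L; rewrite (ideal_mulC (ideal_mul I J)) (ideal_mul_leP I) (ideal_mul_leP K).
split=> H.
  move=> k Kk; apply/ideal_mul_le => i j Ii Jj.
  move/ideal_mul_le: (H i Ii) => /(_ j k Jj Kk).
  by rewrite /imem /= (smulC_ k) -smulA_.
move=> i Ii; apply/ideal_mul_le => j k Jj Kk.
move/ideal_mul_le: (H k Kk) => /(_ i j Ii Jj).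
by rewrite /imem /= (smulC_ k) -smulA_.
Qed.

Program Definition ideal_one : ideal_sl := exist _ (fun _ => True) _.
Next Obligation. by []. Qed.

Lemma ideal_mul1 (I : ideal_sl) : ideal_mul ideal_one I = I.
Proof.
apply: eq_by_ub => K; rewrite ideal_mul_le; split=> [H i Ii|H r i _ Ii].
  by rewrite -(SRmul_1_l (sr_theory R) i); apply: H.
by apply: H; case: (proj2_sig I) => _ _; apply.
Qed.

Lemma ideal_mul_supr (I : ideal_sl) F : ideal_mul I (sup F) = sup (image (ideal_mul I) F).
Proof.
apply: eq_by_ub => K; rewrite sup_image_le ideal_mul_leP.
split=> [H J FJ|H i Ii]; last by apply/sup_le => J FJ; move/ideal_mul_leP: (H J FJ); apply.
by apply/ideal_mul_leP => i Ii; apply: le_trans (H i Ii); apply: sup_ub.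
Qed.

Program Definition ideal_quantale : two_sided_quantale :=
  @TwoSided
    (@Quantale ideal_sl ideal_mul ideal_one ideal_mulA ideal_mulC ideal_mul1 ideal_mul_supr) _.
Next Obligation. by apply: le_antisym; [exact: le_top|]. Qed.

Definition zariski_relations (L : frame) (h : R -> L) : Prop :=
  [/\ h (s0 R) = bot,
      forall f g, h (sadd f g) ⊑ h f ⊔ h g,
      h (s1 R) = qone
    & forall f g, h (smul f g) = h f ⋅ h g].

(* [Z] is the frame presented by the generators [gen f], for [f] in [R],
   subject to [zariski_relations]. *)
Definition is_zariski_frame (Z : frame) (gen : R -> Z) : Prop :=
  zariski_relations gen /\
  forall (L : frame) (h : R -> L), zariski_relations h ->
    exists! k : quanthom Z L, forall f, k (gen f) = h f.

End Ideals.

(* Main.v *)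
From Stdlib Require Import ssreflect ssrfun ssrbool.
From Stdlib Require Import FunctionalExtensionality Ring_theory.
Require Import Defs.

Set Implicit Arguments.
Unset Strict Implicit.
Unset Printing Implicit Defensive.
#[local] Obligation Tactic := idtac.
Local Open Scope suplattice_scope.

(** An element of [Q ⊕ 𝒫R] is a family of coefficients [R -> Q], and in these
    terms the conditions defining [OPAI_bar] are the Zariski relations.  Hence a
    spectrum is a quantale (or frame) freely generated by symbols satisfying
    these relations.  For quantales the ideals of [R] do this, generated by the
    principal ideals: a family [h] satisfying the relations extends to
    [I ↦ sup {h i | i ∈ I}], because [{i | h i ⊑ z}] is always an ideal.  For
    frames the semiprime ideals do, by the same formula.  Finally, the saturated
    opens are the subsets closed under divisors; their dual consists of the
    subsets closed under multiples, with the principal ones as dual bases. *)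

(** * Dualisability in suplattices *)

(** The hypotheses say that each [a] is the join of the [b i] with [ev (c i) a], and dually for [d].
    With [E], the join of all [b i ⊗ c i], as the image of [True] under the unit, these are the two
    triangle identities. *)
Lemma dualisable_of_dual_bases (A D : suplattice) (ev : bimap D A Omega)
    (I : Type) (b : I -> A) (c : I -> D) :
  (forall a z, a ⊑ z <-> forall i, ev (c i) a -> b i ⊑ z) ->
  (forall d z, d ⊑ z <-> forall i, ev d (b i) -> c i ⊑ z) ->
  dualisable A.
Proof.
move=> Hb Hc; pose E : A ⊗ D := sup (fun t => exists i, t = tens (b i) (c i)).
exists D, (bm_left (tlunit_bimap (A ⊗ D)) E), (tlift ev); split=> [a|d].
- rewrite -[tlunit_inv A a]/(tens _ _) tmap_tens -[bm_left _ _ _]/(restrict _ _) restrictT.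
  (* With [a] fixed, the whole composite is a suplattice map in [E], so it can be computed on each
     [tens (b i) (c i)]. *)
  pose F := supcomp (trunit A) (supcomp (tmap (supid A) (tlift ev))
    (supcomp (tassoc A D A) (bm_left (tens_bimap _ A) a))).
  rewrite -[LHS]/(F E); apply: eq_by_ub => z; rewrite supmap_sup_le Hb.
  have FE i : F (tens (b i) (c i)) = restrict (ev (c i) a) (b i).
    rewrite -[LHS]/(trunit A (tmap _ _ (tassoc A D A (tens (tens _ _) _)))).
    by rewrite tassoc_tens tmap_tens tlift_tens /trunit tlift_tens.
  split=> [H i|H _ [i ->]]; last by rewrite FE restrict_le; apply: H.
  by apply/restrict_le; rewrite -FE; apply: H; exists i.
- rewrite -[trunit_inv D d]/(tens _ _) tmap_tens -[bm_left _ _ _]/(restrict _ _) restrictT.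
  pose F := supcomp (tlunit D) (supcomp (tmap (tlift ev) (supid D))
    (supcomp (tassoc_inv D A D) (bm_right (tens_bimap D _) d))).
  rewrite -[LHS]/(F E); apply: eq_by_ub => z; rewrite supmap_sup_le Hc.
  have FE i : F (tens (b i) (c i)) = restrict (ev d (b i)) (c i).
    rewrite -[LHS]/(tlunit D (tmap _ _ (tassoc_inv D A D (tens _ (tens _ _))))).
    by rewrite tassoc_inv_tens tmap_tens tlift_tens /tlunit tlift_tens.
  split=> [H i|H _ [i ->]]; last by rewrite FE restrict_le; apply: H.
  by apply/restrict_le; rewrite -FE; apply: H; exists i.
Qed.

(** * Unique choice of homomorphisms and universal elements *)

(* Unique choice holds without any axiom: the chosen homomorphism is computed
   pointwise as the join of all values. *)
Section UniqueHom.

Variables (P Q : quantale) (Phi : quanthom P Q -> Prop).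
Hypothesis uniq : exists! k, Phi k.

Definition unique_hom_fun (x : P) : Q := sup (fun y => exists2 k, Phi k & y = k x).

Lemma unique_hom_funE k x : Phi k -> unique_hom_fun x = k x.
Proof.
case: uniq => k0 [_ U] Pk; apply: eq_by_ub => z; rewrite sup_le.
split=> [H|H _ [k' Pk' ->]]; first by apply: H; exists k.
by rewrite -(U _ Pk') (U _ Pk).
Qed.

Program Definition unique_hom : quanthom P Q :=
  @Quanthom P Q (@Supmap P Q unique_hom_fun _) _ _.
Next Obligation.
case: uniq => k [Pk _] S; rewrite (unique_hom_funE _ Pk) sm_sup.
by congr sup; apply: predext => y; split=> -[x Sx ->]; exists x; rewrite ?(unique_hom_funE _ Pk).
Qed.
Next Obligation. by case: uniq => k [Pk _]; rewrite /= (unique_hom_funE _ Pk) qh_one. Qed.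
Next Obligation. by case: uniq => k [Pk _] x y; rewrite /= !(unique_hom_funE _ Pk) qh_mul. Qed.

Lemma unique_hom_spec : Phi unique_hom.
Proof.
case: uniq => k [Pk _]; suff -> : unique_hom = k by [].
by apply: quanthom_ext => x; apply: unique_hom_funE.
Qed.

Lemma unique_homE k : Phi k -> k = unique_hom.
Proof. by move=> Pk; apply: quanthom_ext => x; rewrite -(unique_hom_funE _ Pk). Qed.

End UniqueHom.

(** The Yoneda lemma. The inverse [psi] is taken as data because [represents] asks for a function;
    [unique_hom] will supply it. *)
Lemma represents_of_universal_element (C : category) (F : set_functor C) (A : C) (u : F A)
    (psi : forall B, F B -> mor A B) :
  (forall B v, sf_map F (psi B v) u = v) ->
  (forall B (g : mor A B), g = psi B (sf_map F g u)) ->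
  represents F A.
Proof.
move=> E U; exists (fun B g => sf_map F g u), psi; split=> [B B' h g|B g|B v].
- exact: sf_cmp.
- by rewrite -U.
- exact: E.
Qed.

(** * Coefficients of elements of [Q ⊕ discrete X] *)

Section Coefficients.

Variables (Q : two_sided_quantale) (X : Type).

(** The map induced by [S ↦ S x] into [Omega], followed by [Q ⊗ Omega ≅ Q]. As a copairing it is a
    quantale homomorphism by construction. *)
Definition coef (x : X) : quanthom (Q ⊕ discrete X) Q :=
  copair (qid Q) (qcomp (bang Q) (discrete_point x)).

Lemma coef_tens x a S : coef x (tens a S) = restrict (S x) a.
Proof.
rewrite copair_tens; apply: eq_by_ub => z.
rewrite -[qcomp _ _ _]/(restrict (S x) _) qmul_sup_le restrict_le.
split=> [H Sx|H _ [-> Sx]]; last by rewrite qmulC qmul1; apply: H.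
by rewrite -(qmul1 a) qmulC; apply: H.
Qed.

Definition of_coef (h : X -> Q) : Q ⊕ discrete X :=
  sup (fun t => exists x, t = tens (h x) (single x)).

Lemma of_coefK h x : coef x (of_coef h) = h x.
Proof.
apply: eq_by_ub => z; rewrite supmap_sup_le.
split=> [H|H _ [y ->]]; last by rewrite coef_tens restrict_le => <-.
by move: (H _ (ex_intro _ x eq_refl)); rewrite coef_tens restrict_le; apply.
Qed.

Lemma tens_coef_le (u : Q ⊕ discrete X) x : tens (coef x u) (single x) ⊑ u.
Proof.
apply/tens_le; rewrite {2}[u]tensor_gen sm_sup.
apply: tmem_supl => _ [_ [a [S [uaS ->]]] ->]; rewrite coef_tens.
(* The truth value [S x] moves across the tensor, where it restricts [single x] to something below
   [S]. *)
apply/tens_le; rewrite tens_restrict; apply/tens_le.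
apply: tmem_le uaS (le_refl _) _; apply/restrict_le => Sx; exact/single_le.
Qed.

(** If [tens a S ⊑ u], then [S] is the join of its singletons and [a ⊑ coef x u] for each [x] in
    [S]. So elements behave as families [X -> Q] with the pointwise order. *)
Lemma coef_le (u v : Q ⊕ discrete X) : u ⊑ v <-> forall x, coef x u ⊑ coef x v.
Proof.
split=> [uv x|H]; first exact: supmap_mono.
rewrite [u]tensor_gen; apply/tensor_sup_le => a S uaS.
rewrite (discrete_gen S); apply: tmem_supr => _ [x Sx ->].
have vx : tmem v (coef x v) (single x) by apply/tens_le; exact: tens_coef_le.
apply: tmem_le vx _ (le_refl _).
apply: le_trans (H x); move: (supmap_mono (coef x) (proj2 (tens_le a S u) uaS)).
by rewrite coef_tens restrict_le; apply.
Qed.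

Lemma coef_ext (u v : Q ⊕ discrete X) : (forall x, coef x u = coef x v) -> u = v.
Proof. by move=> E; apply: le_antisym; apply/coef_le => x; rewrite E; apply: le_refl. Qed.

(** [coef x] is evaluation at the point [x] followed by the unitor, an isomorphism with inverse
    [a ↦ tens a True]. This handles the conditions at [eps0] and [eps1]. *)
Lemma oplus_point_eq x (u : Q ⊕ discrete X) a :
  oplus (qid Q) (discrete_point x) u = tens a (True : Omega) <-> coef x u = a.
Proof.
have E : coef x u = trunit Q (oplus (qid Q) (discrete_point x) u).
  rewrite -[RHS]/(supcomp (trunit Q) (oplus (qid Q) (discrete_point x)) u).
  congr (sm_fun _ u); apply: tensor_ext => b S.
  by rewrite coef_tens supcompE -[oplus _ _ _]/(tmap _ _ _) tmap_tens /trunit tlift_tens.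
have [K1 K2] := trunitK Q; rewrite E; split=> [->|<-].
  exact: (f_equal (fun f : supmap _ _ => f a) K1).
by symmetry; exact: (f_equal (fun f : supmap _ _ => f _) K2).
Qed.

End Coefficients.

Arguments coef {Q X} x.

Lemma coef_preimage (Q : two_sided_quantale) (X Y : Type) (f : X -> Y) x (u : Q ⊕ discrete Y) :
  coef x (oplus (qid Q) (preimage f) u) = coef (f x) u.
Proof.
rewrite -[LHS]/(supcomp (coef x) (oplus (qid Q) (preimage f)) u).
congr (sm_fun _ u); apply: tensor_ext => a S.
by rewrite supcompE -[oplus _ _ _]/(tmap _ _ _) tmap_tens !coef_tens.
Qed.

Lemma coef_map (P Q : two_sided_quantale) (X : Type) (g : quanthom P Q) x (u : P ⊕ discrete X) :
  coef x (oplus g (qid (discrete X)) u) = g (coef x u).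
Proof.
rewrite -[LHS]/(supcomp (coef x) (oplus g (qid _)) u) -[RHS]/(supcomp g (coef x) u).
congr (sm_fun _ u); apply: tensor_ext => a S.
rewrite !supcompE -[oplus _ _ _]/(tmap _ _ _) tmap_tens !coef_tens.
by apply: eq_by_ub => z; rewrite supmap_sup_le restrict_le; split=> [H _ [-> Sx]|H Sx]; apply: H.
Qed.

(** * Coefficients over a product of two discrete locales *)

Definition unpair (X Y : Type) : quanthom (discrete X ⊕ discrete Y) (discrete (X * Y)) :=
  copair (preimage (@fst X Y)) (preimage (@snd X Y)).

Lemma unpair_inj1 (X Y : Type) :
  qcomp (unpair X Y) (inj1 (discrete X) (discrete Y)) = preimage (@fst X Y).
Proof.
apply: quanthom_ext => U; rewrite -[LHS]/(unpair X Y (tens _ _)) copair_tens qh_one.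
by rewrite qmulC qmul1.
Qed.

Lemma unpair_inj2 (X Y : Type) :
  qcomp (unpair X Y) (inj2 (discrete X) (discrete Y)) = preimage (@snd X Y).
Proof.
by apply: quanthom_ext => U; rewrite -[LHS]/(unpair X Y (tens _ _)) copair_tens qh_one qmul1.
Qed.

Lemma unpair_op (X : Type) (op : X -> X -> X) :
  qcomp (unpair X X) (discrete_op op) = preimage (fun p : X * X => op p.1 p.2).
Proof.
have [K _] := discrete_prodK X X; apply: quanthom_ext => U.
exact: (f_equal (fun f : quanthom _ _ => f (preimage (fun p : X * X => op p.1 p.2) U)) K).
Qed.

Lemma unpair_le (X Y : Type) (U V : discrete X ⊕ discrete Y) :
  unpair X Y U ⊑ unpair X Y V -> U ⊑ V.
Proof.
have [_ K] := discrete_prodK X Y.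
have E W : discrete_prod X Y (unpair X Y W) = W.
  exact: (f_equal (fun f : quanthom _ _ => f W) K).
by move=> H; rewrite -(E U) -(E V); apply: supmap_mono.
Qed.

Section DoubleCoefficients.

Variables (Q : two_sided_quantale) (X Y : Type).

Definition coef2 (x : X) (y : Y) : quanthom (Q ⊕ (discrete X ⊕ discrete Y)) Q :=
  qcomp (coef (x, y)) (oplus (qid Q) (unpair X Y)).

(** [discrete_prod] is inverse to [unpair], so applying [unpair] in the second factor reflects the
    order, which can then be tested at pairs. *)
Lemma coef2_le (u v : Q ⊕ (discrete X ⊕ discrete Y)) :
  u ⊑ v <-> forall x y, coef2 x y u ⊑ coef2 x y v.
Proof.
split=> [uv x y|H]; first exact: supmap_mono.
have [_ K] := discrete_prodK X Y.
have E W : oplus (qid Q) (discrete_prod X Y) (oplus (qid Q) (unpair X Y) W) = W.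
  have EQ : qcomp (qid Q) (qid Q) = qid Q by apply: quanthom_ext.
  rewrite -oplus_comp EQ.
  rewrite -[RHS](oplus_id (A := Q) (B := discrete X ⊕ discrete Y)).
  by congr (oplus _ _ W).
rewrite -(E u) -(E v); apply: supmap_mono; apply/coef_le => -[x y]; exact: H.
Qed.

(** Treats the two injections and the two operations uniformly: after [unpair] each is the preimage
    along a projection or an operation. *)
Lemma coef2_oplus (Z : Type) (m : quanthom (discrete Z) (discrete X ⊕ discrete Y))
    (f : X * Y -> Z) x y (u : Q ⊕ discrete Z) :
  qcomp (unpair X Y) m = preimage f -> coef2 x y (oplus (qid Q) m u) = coef (f (x, y)) u.
Proof.
have EQ : qcomp (qid Q) (qid Q) = qid Q by apply: quanthom_ext.
move=> E; rewrite -[LHS]/(coef (x, y) (oplus _ _ (oplus _ _ u))) -oplus_comp EQ E.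
exact: coef_preimage.
Qed.

End DoubleCoefficients.

Arguments coef2 {Q X Y} x y.

(** * Approximability of discrete semirings *)

Lemma discrete_overt (X : Type) : overt (discrete X).
Proof.
exists (fun U => exists x, U x) => U p; split=> [H x Ux|H [x Ux]].
  by exists (fun _ => True) => //; split=> //; apply: H; exists x.
by case: (H x Ux) => _ [_ hp] _.
Qed.

Section DiscreteSemiring.

Variable R : semiring.

Lemma smul1 (a : R) : smul (s1 R) a = a.
Proof. exact: (SRmul_1_l (sr_theory R)). Qed.

Lemma smul0 (a : R) : smul (s0 R) a = s0 R.
Proof. exact: (SRmul_0_l (sr_theory R)). Qed.

Lemma smulDl (a b c : R) : smul (sadd a b) c = sadd (smul a c) (smul b c).
Proof. exact: (SRdistr_l (sr_theory R)). Qed.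

Lemma smulDr (a b c : R) : smul a (sadd b c) = sadd (smul a b) (smul a c).
Proof. by rewrite smulC_ smulDl !(smulC_ a). Qed.

(** Under [unpair], which reflects the order, the two sides become the sets of pairs [(x, y)] with
    [smul x y] in [s] and with [x] in [s]. *)
Lemma saturated_discrete (s : discrete R) :
  discrete_op (@smul R) s ⊑ inj1 _ _ s <-> forall x y, s (smul x y) -> s x.
Proof.
have E1 := f_equal (fun f : quanthom _ _ => f s) (unpair_op (@smul R)).
have E2 := f_equal (fun f : quanthom _ _ => f s) (unpair_inj1 R R).
split=> [H x y sxy|H]; last first.
  apply: unpair_le; rewrite -[unpair _ _ (discrete_op _ _)]/(qcomp _ _ s) E1.
  by rewrite -[unpair _ _ _]/(qcomp _ _ s) E2 => -[x y]; apply: H.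
move: (supmap_mono (unpair R R) H).
rewrite -[unpair _ _ (discrete_op _ _)]/(qcomp _ _ s) E1.
by rewrite -[unpair _ _ _]/(qcomp _ _ s) E2 => /(_ (x, y)); apply.
Qed.

Program Definition multiple_closed : suplattice :=
  @Suplattice {t : R -> Prop | forall x y, t x -> t (smul x y)}
    (fun t t' => forall x, proj1_sig t x -> proj1_sig t' x)
    (fun F => exist _ (fun x => exists2 t, F t & proj1_sig t x) _) _ _ _ _.
Next Obligation. by move=> F x y [t Ft tx]; exists t => //; apply: (proj2_sig t). Qed.
Next Obligation. by []. Qed.
Next Obligation. by move=> s t w st tw x /st/tw. Qed.
Next Obligation.
by move=> s t st ts; apply: sig_ext; apply: predext => x; split; [apply: st|apply: ts].
Qed.
Next Obligation.
by move=> F t; split=> [H s Fs x sx|H x [s /H]]; [apply: H; exists s|apply].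
Qed.

Program Definition overlap :
    bimap multiple_closed (saturated (discrete_semiring R)) Omega :=
  @Bimap multiple_closed (saturated (discrete_semiring R)) Omega
    (fun t s => exists2 x, proj1_sig t x & proj1_sig s x) _ _.
Next Obligation.
move=> F s; apply: (@le_antisym Omega).
  move=> [x [t Ft tx] sx]; exists (exists2 x, proj1_sig t x & proj1_sig s x).
  by split; [exists t|exists x].
by move=> [_ [[t Ft ->] [x tx sx]]]; exists x => //; exists t.
Qed.
Next Obligation.
move=> t F; apply: (@le_antisym Omega).
  move=> [x tx [_ [s Fs ->] sx]]; exists (exists2 x, proj1_sig t x & proj1_sig s x).
  by split; [exists s|exists x].
by move=> [_ [[s Fs ->] [x tx sx]]]; exists x => //; exists (proj1_sig s) => //; exists s.
Qed.

Program Definition divisors (r : R) : saturated (discrete_semiring R) :=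
  exist _ (fun x => exists y, r = smul x y) _.
Next Obligation.
by move=> r; apply/saturated_discrete => x y [z ->]; exists (smul y z); rewrite smulA_.
Qed.

Program Definition multiples (r : R) : multiple_closed :=
  exist _ (fun x => exists y, x = smul r y) _.
Next Obligation. by move=> r x y [z ->]; exists (smul z y); rewrite smulA_. Qed.

(** By the closure properties, [t] meets [divisors r] exactly when [r] is in [t], and [multiples r]
    meets [s] exactly when [r] is in [s]. Hence the two families are dual bases for [overlap]. *)
Lemma approximable_discrete : approximable (discrete_semiring R).
Proof.
split; first exact: discrete_overt.
have smulr1 (r : R) : r = smul r (s1 R) by rewrite smulC_ smul1.
apply: (@dualisable_of_dual_bases _ _ overlap R divisors multiples) => [s z|t z].
- have down (w : saturated (discrete_semiring R)) := proj1 (saturated_discrete _) (proj2_sig w).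
  split=> [sz r [x [y ->] /sz /down zr] x' [y' E]|H x sx].
    by apply: (down z _ y'); rewrite -E.
  by apply: (H x); [exists x => //|]; exists (s1 R).
- split=> [tz r [x tx [y ->]] _ [z' ->]|H x tx].
    by apply: (proj2_sig z); apply: (proj2_sig z); apply: tz.
  by apply: (H x); [exists x => //|]; exists (s1 R).
Qed.

(** * Spectra as free objects on the Zariski relations *)

(* On frames this is [zariski_relations]. *)
Definition quantic_relations (Q : two_sided_quantale) (h : R -> Q) : Prop :=
  [/\ h (s0 R) = bot,
      forall f g, h (sadd f g) ⊑ h f ⊔ h g,
      h (s1 R) = qone
    & forall f g, h (smul f g) = h f ⋅ h g].

(** The conditions are compared coefficientwise: those for zero and one at a point, those for
    addition and multiplication at pairs. *)
Lemma is_opai_coef (Q : two_sided_quantale) (u : Q ⊕ discrete R) :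
  is_opai (R := discrete_semiring R) u <-> quantic_relations (fun r => coef r u).
Proof.
(* [oplus_point_eq] speaks of tensors with [True]; [qone] has this form by definition, while [bot]
   has to be rewritten. *)
have E0 : (bot : Q ⊕ Omega_frame) = tens bot (True : Omega).
  by symmetry; exact: (supmap_bot (trunit_inv Q)).
have Ei1 x y : coef2 x y (oplus (qid Q) (inj1 (discrete R) (discrete R)) u) = coef x u.
  exact: coef2_oplus (unpair_inj1 R R).
have Ei2 x y : coef2 x y (oplus (qid Q) (inj2 (discrete R) (discrete R)) u) = coef y u.
  exact: coef2_oplus (unpair_inj2 R R).
have Eop op x y : coef2 x y (oplus (qid Q) (discrete_op op) u) = coef (op x y) u.
  exact: coef2_oplus (unpair_op op).
split=> [[H0 H1 Ha Hm]|[H0 Ha H1 Hm]]; split.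
- by apply/oplus_point_eq; rewrite -E0.
- by move=> f g; move/coef2_le: Ha => /(_ f g); rewrite supmap_join Eop Ei1 Ei2.
- exact/oplus_point_eq.
- by move=> f g; move: (f_equal (coef2 f g) Hm); rewrite qh_mul Eop Ei1 Ei2.
- by rewrite E0; apply/oplus_point_eq.
- exact/oplus_point_eq.
- by apply/coef2_le => x y; rewrite supmap_join Eop Ei1 Ei2.
- apply: le_antisym; apply/coef2_le => x y; rewrite qh_mul Eop Ei1 Ei2 Hm; exact: le_refl.
Qed.

Lemma opai_of_relations (Q : two_sided_quantale) (h : R -> Q) :
  quantic_relations h -> is_opai (R := discrete_semiring R) (of_coef h).
Proof.
move=> H; apply/is_opai_coef; suff -> : (fun r => coef r (of_coef h)) = h by [].
by apply: functional_extensionality => r; rewrite of_coefK.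
Qed.

Lemma oplus_of_coef (P Q : two_sided_quantale) (gen : R -> P) (g : quanthom P Q)
    (u : Q ⊕ discrete R) :
  oplus g (qid (discrete R)) (of_coef gen) = u <-> forall r, g (gen r) = coef r u.
Proof.
split=> [<- r|E]; first by rewrite coef_map of_coefK.
by apply: coef_ext => r; rewrite coef_map of_coefK.
Qed.

(** The universal element has coefficients [gen]. Its image under [g] has coefficients [g (gen r)],
    so freeness is the condition of the Yoneda lemma. *)
Lemma quantic_spectrum_of_free (P : two_sided_quantale) (gen : R -> P) :
  quantic_relations gen ->
  (forall (Q : two_sided_quantale) (h : R -> Q), quantic_relations h ->
     exists! k : quanthom P Q, forall r, k (gen r) = h r) ->
  is_quantic_spectrum (discrete_semiring R) P.
Proof.
move=> Hgen free.
pose u : OPAI_bar (discrete_semiring R) P := exist _ (of_coef gen) (opai_of_relations Hgen).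
pose uniq (Q : two_sided_quantale) (v : OPAI_bar (discrete_semiring R) Q) :=
  free Q _ (proj1 (is_opai_coef _) (proj2_sig v)).
apply: (@represents_of_universal_element Quant_top _ P u (fun Q v => unique_hom (uniq Q v))).
- move=> Q v; apply: sig_ext; exact: (proj2 (oplus_of_coef gen _ _) (unique_hom_spec (uniq Q v))).
- by move=> Q g; apply: (unique_homE (uniq Q _)); apply/(oplus_of_coef gen g).
Qed.

Lemma localic_spectrum_of_zariski (Z : frame) (gen : R -> Z) :
  is_zariski_frame gen -> is_localic_spectrum (discrete_semiring R) Z.
Proof.
move=> [Hgen free].
pose u : OPAI (discrete_semiring R) Z := exist _ (of_coef gen) (opai_of_relations Hgen).
pose uniq (L : frame) (v : OPAI (discrete_semiring R) L) :=
  free L _ (proj1 (is_opai_coef _) (proj2_sig v)).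
apply: (@represents_of_universal_element (opposite Loc) _ Z u (fun L v => unique_hom (uniq L v))).
- move=> L v; apply: sig_ext; exact: (proj2 (oplus_of_coef gen _ _) (unique_hom_spec (uniq L v))).
- by move=> L g; apply: (unique_homE (uniq L _)); apply/(oplus_of_coef gen g).
Qed.

(** * Ideals as the free two-sided quantale *)

(** Two-sidedness enters here, through [h r ⊑ qone]. *)
Lemma relations_mul_le (Q : two_sided_quantale) (h : R -> Q) r a :
  quantic_relations h -> h (smul r a) ⊑ h a.
Proof.
move=> [_ _ _ hM]; rewrite hM -{2}(qmul1 (h a)).
by apply: qmul_le (le_refl _); apply: le_one.
Qed.

Lemma below_ideal (Q : two_sided_quantale) (h : R -> Q) z :
  quantic_relations h -> is_ideal (fun i => h i ⊑ z).
Proof.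
move=> Hh; case: (Hh) => h0 hD _ _; split=> [|a b az bz|r a az].
- by rewrite h0; apply: bot_le.
- by apply: le_trans (hD a b) _; apply/join_le.
- by apply: le_trans (relations_mul_le r a Hh) az.
Qed.

Program Definition principal (r : R) : ideal R := exist _ (fun x => exists y, x = smul r y) _.
Next Obligation.
move=> r; split=> [|_ _ [x ->] [y ->]|s _ [x ->]].
- by exists (s0 R); rewrite smulC_ smul0.
- by exists (sadd x y); rewrite smulDr.
- by exists (smul s x); rewrite smulA_ (smulC_ s) -smulA_.
Qed.

Lemma principal_le r (I : ideal_sl R) : (principal r : ideal_sl R) ⊑ I <-> imem I r.
Proof.
split=> [H|Ir _ [x ->]]; first by apply: H; exists (s1 R); rewrite smulC_ smul1.
by rewrite smulC_; case: (proj2_sig I) => _ _; apply.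
Qed.

Lemma principal_relations : quantic_relations (Q := ideal_quantale R) principal.
Proof.
split=> [|f g||f g].
- apply: (@eq_by_ub (ideal_sl R)) => z; rewrite principal_le; split=> _; first exact: bot_le.
  by case: (proj2_sig z).
- apply/(principal_le _ (join (A := ideal_sl R) _ _)).
  set J := join _ _.
  have [_ JD _] := proj2_sig J; apply: JD; apply/(principal_le _ J);
    apply: sup_ub; by [left|right].
- apply: (@le_antisym (ideal_sl R)); first by [].
  by move=> x _; exists x; rewrite smul1.
- apply: (@eq_by_ub (ideal_sl R)) => z; rewrite principal_le ideal_mul_le.
  split=> [H _ _ [x ->] [y ->]|]; last first.
    by apply; exists (s1 R); rewrite smulC_ smul1.
  (* Rearranged as a multiple of [smul f g], which lies in [z]. *)
  have -> : smul (smul f x) (smul g y) = smul (smul x y) (smul f g).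
    by rewrite (smulC_ f) -!smulA_ (smulC_ y) -smulA_.
  by case: (proj2_sig z) => _ _; apply.
Qed.

Section Extension.

Variables (Q : two_sided_quantale) (h : R -> Q).

(** Defined on all subsets so as to serve both ideals and semiprime ideals. *)
Definition ideal_ext (I : R -> Prop) : Q := sup (image h I).

Hypothesis Hh : quantic_relations h.

(** Multiplication distributes over both joins and [h] is multiplicative. The right side matches
    [ideal_mul_le] and [semiprime_meet_le], which makes both extensions multiplicative. *)
Lemma ideal_ext_mul (I J : R -> Prop) z :
  ideal_ext I ⋅ ideal_ext J ⊑ z <-> forall i j, I i -> J j -> h (smul i j) ⊑ z.
Proof.
have [_ _ _ hM] := Hh; rewrite qmul_sup_le; split=> [H i j Ii Jj|H _ [j Jj ->]].
  have {}H := H _ (ex_intro2 _ _ j Jj eq_refl).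
  move: H; rewrite qmulC qmul_sup_le => /(_ _ (ex_intro2 _ _ i Ii eq_refl)).
  by rewrite -hM smulC_.
by rewrite qmulC qmul_sup_le => _ [i Ii ->]; rewrite -hM smulC_; apply: H.
Qed.

Lemma ideal_ext_one : ideal_ext (fun _ => True) = qone.
Proof.
have [_ _ h1 _] := Hh; apply: le_antisym; first exact: le_one.
by rewrite -h1; apply: sup_ub; exists (s1 R).
Qed.

Lemma ideal_ext_principal r : ideal_ext (imem (principal r)) = h r.
Proof.
apply: eq_by_ub => z; rewrite sup_image_le.
exact: (principal_le r (exist _ _ (below_ideal z Hh))).
Qed.

End Extension.

Program Definition ideal_hom (Q : two_sided_quantale) (h : R -> Q) (Hh : quantic_relations h) :
    quanthom (ideal_quantale R) Q :=
  @Quanthom (ideal_quantale R) Q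
    (@Supmap (ideal_quantale R) Q (fun I => ideal_ext h (imem I)) _) _ _.
Next Obligation.
move=> Q h Hh F; apply: eq_by_ub => z.
(* The extension is left adjoint to [z ↦ K], hence preserves joins. *)
pose K : ideal_sl R := exist _ _ (below_ideal z Hh).
have E (I : ideal_sl R) : ideal_ext h (imem I) ⊑ z <-> I ⊑ K by exact: sup_image_le.
by rewrite sup_image_le E sup_le; split=> H I FI; apply/E/H.
Qed.
Next Obligation. by move=> Q h Hh; apply: ideal_ext_one. Qed.
Next Obligation.
move=> Q h Hh I J; apply: eq_by_ub => z; rewrite ideal_ext_mul //.
pose K : ideal_sl R := exist _ _ (below_ideal z Hh).
apply: iff_trans (ideal_mul_le I J K); exact: sup_image_le.
Qed.

Lemma ideal_gen (I : ideal_sl R) :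
  I = sup (image (principal : R -> ideal_sl R) (imem I)).
Proof.
by apply: eq_by_ub => J; rewrite sup_image_le; split=> H r /H /principal_le.
Qed.

Lemma ideal_free (Q : two_sided_quantale) (h : R -> Q) : quantic_relations h ->
  exists! k : quanthom (ideal_quantale R) Q, forall r, k (principal r) = h r.
Proof.
move=> Hh; exists (ideal_hom Hh); split=> [r|k E]; first exact: ideal_ext_principal.
apply: quanthom_ext => I; apply: eq_by_ub => z.
rewrite -[ideal_hom Hh I]/(ideal_ext _ _) sup_image_le {2}(ideal_gen I) sm_sup sup_le.
split=> [H _ [_ [r Ir ->] ->]|H r Ir]; first by rewrite E; apply: H.
by apply: H; exists (principal r) => //; exists r.
Qed.

(** * Semiprime ideals as the Zariski frame *)

Definition is_semiprime (I : R -> Prop) : Prop := is_ideal I /\ forall a, I (smul a a) -> I a.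

Definition semiprime := {I : R -> Prop | is_semiprime I}.

Definition pmem (I : semiprime) : R -> Prop := proj1_sig I.

(** The radical ideal generated by [S], formed as an intersection rather than through powers of
    elements. *)
Program Definition radical (S : R -> Prop) : semiprime :=
  exist _ (fun a => forall I : semiprime, (forall x, S x -> pmem I x) -> pmem I a) _.
Next Obligation.
move=> S; split; first split=> [I _|a b Ha Hb I SI|r a Ha I SI];
  last (by move=> a Ha I SI; case: (proj2_sig I) => _; apply; apply: Ha);
  case: (proj2_sig I) => -[I0 Ia Im] _.
- exact: I0.
- by apply: Ia; [apply: Ha|apply: Hb].
- by apply: Im; apply: Ha.
Qed.

Lemma radical_le S (I : semiprime) :
  (forall x, pmem (radical S) x -> pmem I x) <-> forall x, S x -> pmem I x.
Proof. by split=> [H x Sx|H x]; [apply: H => J; apply|apply]. Qed.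

Program Definition semiprime_sl : suplattice :=
  @Suplattice semiprime (fun I J => forall x, pmem I x -> pmem J x)
    (fun F => radical (fun x => exists2 I, F I & pmem I x)) _ _ _ _.
Next Obligation. by []. Qed.
Next Obligation. by move=> I J K IJ JK x /IJ/JK. Qed.
Next Obligation.
by move=> I J IJ JI; apply: sig_ext; apply: predext => x; split; [apply: IJ|apply: JI].
Qed.
Next Obligation.
move=> F J; apply: iff_trans (radical_le _ _) _; split=> [H I FI x Ix|H x [I FI Ix]].
  by apply: H; exists I.
exact: H FI x Ix.
Qed.

Program Definition semiprime_meet (I J : semiprime_sl) : semiprime_sl :=
  exist _ (fun x => pmem I x /\ pmem J x) _.
Next Obligation.
move=> I J; case: (proj2_sig I) (proj2_sig J) => -[I0 ID IM] IS [[J0 JD JM] JS].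
split; first split=> [//|a b [? ?] [? ?]|r a [? ?]].
- by split; [apply: ID|apply: JD].
- by split; [apply: IM|apply: JM].
- by move=> a [? ?]; split; [apply: IS|apply: JS].
Qed.

Program Definition semiprime_one : semiprime_sl := exist _ (fun _ => True) _.
Next Obligation. by []. Qed.

Program Definition semiprime_quotient (K : semiprime) (a : R) : semiprime :=
  exist _ (fun x => pmem K (smul a x)) _.
Next Obligation.
move=> K a; case: (proj2_sig K) => -[K0 KD KM] KS; split; first split=> [|x y Kx Ky|r x Kx].
- by rewrite smulC_ smul0.
- by rewrite smulDr; apply: KD.
- by rewrite smulA_ (smulC_ a) -smulA_; apply: KM.
(* The square of [a x] is [a] times [a (x x)], and the latter factor is in [K]. *)
- move=> x Kx; apply: KS; rewrite -smulA_ (smulA_ x) (smulC_ x) -smulA_; exact: KM.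
Qed.

(** An [x] in both [I] and [J] has its square among the products, so semiprimeness of [K] puts [x]
    in [K]. *)
Lemma semiprime_meet_le (I J K : semiprime_sl) :
  semiprime_meet I J ⊑ K <-> forall i j, pmem I i -> pmem J j -> pmem K (smul i j).
Proof.
case: (proj2_sig I) (proj2_sig J) (proj2_sig K) => -[_ _ IM] _ [[_ _ JM] _] [_ KS].
split=> [H i j Ii Jj|H x [Ix Jx]]; last exact/KS/H.
by apply: H; split; [rewrite smulC_; apply: IM|apply: JM].
Qed.

Program Definition semiprime_quantale : quantale :=
  @Quantale semiprime_sl semiprime_meet semiprime_one _ _ _ _.
Next Obligation. by move=> I J K; apply: sig_ext; apply: predext => x /=; rewrite /pmem /=; tauto. Qed.
Next Obligation. by move=> I J; apply: sig_ext; apply: predext => x /=; tauto. Qed.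
Next Obligation. by move=> I; apply: sig_ext; apply: predext => x /=; rewrite /pmem; tauto. Qed.
Next Obligation.
move=> I F; apply: eq_by_ub => K; rewrite sup_image_le semiprime_meet_le.
split=> [H J FJ|H i j Ii].
  apply/semiprime_meet_le => i j Ii Jj; apply: H => //.
  have JF : J ⊑ sup F by exact: sup_ub.
  exact: JF.
(* Distributivity follows by residuation: the quotient by [i] is itself semiprime, so it suffices to
   bound each member of [F]. *)
suff /(_ j) : sup F ⊑ (semiprime_quotient K i : semiprime_sl) by [].
by apply/sup_le => J FJ j' Jj'; move/semiprime_meet_le: (H J FJ); apply.
Qed.

Program Definition semiprime_ts : two_sided_quantale := @TwoSided semiprime_quantale _.
Next Obligation. by apply: le_antisym; [exact: le_top|]. Qed.

Program Definition semiprime_frame : frame := @Frame semiprime_ts _.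
Next Obligation. by move=> I; apply: sig_ext; apply: predext => x /=; rewrite /pmem; tauto. Qed.

Definition radical1 (r : R) : semiprime_frame := radical (fun x => x = r).

Lemma radical1_le r (I : semiprime_sl) : radical1 r ⊑ I <-> pmem I r.
Proof. by apply: iff_trans (radical_le _ _) _; split=> [H|Ir x ->] //; apply: H. Qed.

Lemma radical1_relations : zariski_relations radical1.
Proof.
split=> [|f g||f g].
- apply: eq_by_ub => z; rewrite radical1_le; split=> _; first exact: bot_le.
  by case: (proj2_sig z) => -[].
- apply/radical1_le; set J := join _ _.
  have [[_ JD _] _] := proj2_sig J; apply: JD; apply/(radical1_le _ J);
    apply: sup_ub; by [left|right].
- apply: le_antisym; first by [].
  move=> x _ I H; have [[_ _ IM] _] := proj2_sig I.
  by rewrite -(smul1 x) smulC_; apply: IM; apply: H.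
- apply: eq_by_ub => z; rewrite radical1_le semiprime_meet_le.
  split=> [zfg|]; last by apply; apply/(radical1_le _ (radical1 _))/le_refl.
  (* Two quotients in turn: [g], hence its radical, lies in the quotient of [z] by [f]; then for
     each [j] in that radical, [f] and hence its radical lie in the quotient by [j]. *)
  have /radical1_le : pmem (semiprime_quotient z f) g by [].
  move=> H i j fi /H {H} zj; rewrite /pmem /= -/(pmem z _) in zj.
  rewrite smulC_; move: i fi; apply/(radical1_le f (semiprime_quotient z j)).
  by rewrite /pmem /= smulC_.
Qed.

(** Idempotence of [L] enters here: [h (smul a a)] equals [h a]. *)
Lemma below_semiprime (L : frame) (h : R -> L) z :
  zariski_relations h -> is_semiprime (fun i => h i ⊑ z).
Proof.
move=> Hh; split; first exact: below_ideal.
by case: Hh => _ _ _ hM a; rewrite hM fr_idem.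
Qed.

Program Definition semiprime_hom (L : frame) (h : R -> L) (Hh : zariski_relations h) :
    quanthom semiprime_frame L :=
  @Quanthom semiprime_frame L
    (@Supmap semiprime_frame L (fun I => ideal_ext h (pmem I)) _) _ _.
Next Obligation.
move=> L h Hh F; apply: eq_by_ub => z.
pose K : semiprime_sl := exist _ _ (below_semiprime z Hh).
have E (I : semiprime_sl) : ideal_ext h (pmem I) ⊑ z <-> I ⊑ K by exact: sup_image_le.
by rewrite sup_image_le E sup_le; split=> H I FI; apply/E/H.
Qed.
Next Obligation. by move=> L h Hh; apply: ideal_ext_one. Qed.
Next Obligation.
move=> L h Hh I J; apply: eq_by_ub => z; rewrite ideal_ext_mul //.
pose K : semiprime_sl := exist _ _ (below_semiprime z Hh).
apply: iff_trans (semiprime_meet_le I J K); exact: sup_image_le.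
Qed.

Lemma semiprime_gen (I : semiprime_sl) : I = sup (image radical1 (pmem I)).
Proof. by apply: eq_by_ub => J; rewrite sup_image_le; split=> H r /H /radical1_le. Qed.

Lemma semiprime_zariski : is_zariski_frame radical1.
Proof.
split=> [|L h Hh]; first exact: radical1_relations.
exists (semiprime_hom Hh); split=> [r|k E].
  apply: eq_by_ub => z; rewrite -[semiprime_hom Hh _]/(ideal_ext _ _) sup_image_le.
  exact: (radical1_le r (exist _ _ (below_semiprime z Hh))).
apply: quanthom_ext => I; apply: eq_by_ub => z.
rewrite -[semiprime_hom Hh I]/(ideal_ext _ _) sup_image_le {2}(semiprime_gen I) sm_sup sup_le.
split=> [H _ [_ [r Ir ->] ->]|H r Ir]; first by rewrite E; apply: H.
by apply: H; exists (radical1 r) => //; exists r.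
Qed.

End DiscreteSemiring.

Theorem proposition5p3 (R : semiring) :
  approximable (discrete_semiring R) /\
  is_quantic_spectrum (discrete_semiring R) (ideal_quantale R) /\
  (exists (Z : frame) (gen : R -> Z), is_zariski_frame gen) /\
  (forall (Z : frame) (gen : R -> Z),
     is_zariski_frame gen -> is_localic_spectrum (discrete_semiring R) Z).
Proof.
split; first exact: approximable_discrete.
split; first exact: quantic_spectrum_of_free (principal_relations R) (@ideal_free R).
split; last exact: localic_spectrum_of_zariski.
(* This witness shows that the presented frame exists, so the claim about every such presentation is
   not vacuous. *)
by exists (semiprime_frame R), (@radical1 R); apply: semiprime_zariski.
Qed.
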